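(* There is a universal constant $c>0$ such that for every $d\ge 1$, every $d$-dimensional lattice $\Lambda\subset\mathbb{R}^d$ and every convex body $C\subset\mathbb{R}^d$ the following hold. (1) If $C$ is lattice reduced with respect to $\Lambda$, then the width directions of $C$ (the vectors $y\in\Lambda^\star\setminus\{0\}$ with $\max_{a,b\in C}y\cdot(a-b)=\mathrm{wdt}_\Lambda(C)$) span a linear space of dimension at least $c\log d$. (2) If $C$ is lattice complete with respect to $\Lambda$, then the vectors $v\in\Lambda\setminus\{0\}$ for which there exists a lattice segment in $C$ parallel to $v$ of lattice length $\mathrm{diam}_\Lambda(C)$ span a linear space of dimension at least $c\log d$. In both statements the order of magnitude $\log d$ is best possible.
   Context: A convex body is a compact convex set in $\mathbb{R}^d$ with non-empty interior. A lattice $\Lambda\subset\mathbb{R}^d$ is a discrete subgroup; it is $d$-dimensional if it spans $\mathbb{R}^d$. The dual lattice is $\Lambda^\star=\{y: x\cdot y\in\mathbb{Z}\ \forall x\in\Lambda\}$. The lattice width is $\mathrm{wdt}_\Lambda(C)=\min_{y\in\Lambda^\star\setminus\{0\}}\max_{a,b\in C} y\cdot(a-b)$. A segment $[a,b]$ is a lattice segment if $b-a$ is parallel to a nonzero vector of $\Lambda$; its lattice length is $|b-a|/|v|$ where $v$ is the generator of $\Lambda\cap\mathrm{span}\{b-a\}$ that is a positive multiple of $b-a$. The lattice diameter $\mathrm{diam}_\Lambda(C)$ is the maximum lattice length of a lattice segment in $C$. $C$ is lattice reduced if no convex body $C'\subsetneq C$ has the same lattice width; lattice complete if no convex body $C'\supsetneq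 C$ has the same lattice diameter. *)

(* Defs.v *)
From HB Require Import structures.
From mathcomp Require Import all_boot all_order all_algebra.
From mathcomp Require Import all_classical all_reals all_analysis.
Set Implicit Arguments. Unset Strict Implicit. Unset Printing Implicit Defensive.
Import Order.TTheory GRing.Theory Num.Theory.
Import numFieldNormedType.Exports.
Local Open Scope classical_set_scope.
Local Open Scope ring_scope.

Section Defs.
Variables (R : realType) (d : nat).
Notation V := 'rV[R]_d.

Definition dotv (u v : V) : R := \sum_(i < d) u 0 i * v 0 i.

Definition dim_span_ge (S : set V) (m : nat) : Prop :=
  exists (k : nat) (M : 'M[R]_(k, d)), (forall i, S (row i M)) /\ (m <= \rank M)%N.

Definition dim_span_le (S : set V) (x : R) : Prop :=
  forall (k : nat) (M : 'M[R]_(k, d)), (forall i, S (row i M)) -> (\rank M)%:R <= x.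

Definition is_lattice (L : set V) : Prop :=
  [/\ L 0,
      (forall x y, L x -> L y -> L (x - y)),
      (\forall x \near (0 : V), L x -> x = 0)
    & dim_span_ge L d].

Definition dual_lattice (L : set V) : set V :=
  [set y | forall x, L x -> exists z : int, dotv x y = z%:~R].

Definition convex_set (C : set V) : Prop :=
  forall a b (t : R), C a -> C b -> 0 <= t -> t <= 1 -> C (t *: a + (1 - t) *: b).

Definition convex_body (C : set V) : Prop :=
  [/\ compact C, convex_set C & interior C !=set0].

Definition dir_width (C : set V) (y : V) : R :=
  sup [set dotv y (a - b) | a in C & b in C].

Definition lattice_width (L C : set V) : R :=
  inf [set dir_width C y | y in [set y | dual_lattice L y /\ y != 0]].

Definition lattice_reduced (L C : set V) : Prop :=
  forall C', convex_body C' -> C' `<` C -> lattice_width L C' <> lattice_width L C.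

Definition width_directions (L C : set V) : set V :=
  [set y | dual_lattice L y /\ y != 0 /\ dir_width C y = lattice_width L C].

(* v generates L ∩ span{v} on the positive side: primitive lattice vector *)
Definition primitive_vec (L : set V) (v : V) : Prop :=
  [/\ L v, v != 0 & forall s : R, 0 < s -> s < 1 -> ~ L (s *: v)].

(* [a,b] is a lattice segment of lattice length t in the direction of the
   primitive vector w: b - a = t w, t >= 0 *)
Definition lattice_segment (L : set V) (a b w : V) (t : R) : Prop :=
  [/\ primitive_vec L w, 0 <= t & b - a = t *: w].

Definition lattice_diam (L C : set V) : R :=
  sup [set t | exists a b w, [/\ C a, C b & lattice_segment L a b w t]].

Definition lattice_complete (L C : set V) : Prop :=
  forall C', convex_body C' -> C `<` C' -> lattice_diam L C' <> lattice_diam L C.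

Definition diameter_directions (L C : set V) : set V :=
  [set v | L v /\ v != 0 /\
     exists a b w, [/\ C a, C b, lattice_segment L a b w (lattice_diam L C)
                       & exists s : R, s != 0 /\ v = s *: w]].

End Defs.

(* Main.v *)
(* Lower bounds.  Let W be the set of width directions of a reduced body (resp. of
   primitive diameter directions of a complete body).
   - |W| >= d.  With fewer directions one could cut off (resp. glue on) a small piece of
     the body along a direction that W does not see, without changing the lattice width
     (resp. diameter): the remaining lattice vectors leave a positive gap.
   - |W| <= 3^r with r = dim span W.  W spans a group with r generators, and two members
     of W congruent mod 3 would yield a lattice vector (w - w') / 3 of width at most 2/3 of
     the minimum (resp. a lattice direction with a longer segment).
   Hence r >= log_3 d.
   Sharpness.  Scaled by two, the Voronoi cell of A_k^* has no interior lattice point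
   besides 0, while each of its 2 (2^k - 1) facets has a lattice point in its relative
   interior.  With k about log_2 d, at least d of the pairs of facets can be tilted into
   e = d - k extra dimensions so steeply that all short integer vectors stay in the
   k-dimensional coordinate subspace.  The resulting polytope is complete, and its polar
   body is reduced. *)

Require Import Defs.
From HB Require Import structures.
From mathcomp Require Import all_boot all_order all_algebra.
From mathcomp Require Import all_classical all_reals all_analysis.
From mathcomp Require Import ring lra zify.
Import Order.TTheory GRing.Theory Num.Theory.
Import numFieldNormedType.Exports.
Set Implicit Arguments. Unset Strict Implicit. Unset Printing Implicit Defensive.
Local Open Scope classical_set_scope.
Local Open Scope ring_scope.

(** * The dot product and directional widths *)

Section DotProduct.
Context {R : realType} {d : nat}.
Implicit Types (x y z : 'rV[R]_d) (C : set 'rV[R]_d).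

Lemma dotvE x y : dotv x y = (x *m y^T) 0 0.
Proof. by rewrite mxE; apply: eq_bigr => i _; rewrite mxE. Qed.

Lemma dotvC x y : dotv x y = dotv y x.
Proof. by apply: eq_bigr => i _; rewrite mulrC. Qed.

Lemma dotvDr x y z : dotv x (y + z) = dotv x y + dotv x z.
Proof. by rewrite !dotvE linearD mulmxDr mxE. Qed.

Lemma dotvZr t x y : dotv x (t *: y) = t * dotv x y.
Proof. by rewrite !dotvE linearZ -scalemxAr mxE. Qed.

Lemma dotvNr x y : dotv x (- y) = - dotv x y.
Proof. by rewrite -scaleN1r dotvZr mulN1r. Qed.

Lemma dotvBr x y z : dotv x (y - z) = dotv x y - dotv x z.
Proof. by rewrite dotvDr dotvNr. Qed.

Lemma dotvDl x y z : dotv (x + y) z = dotv x z + dotv y z.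
Proof. by rewrite dotvC dotvDr !(dotvC z). Qed.

Lemma dotvZl t x y : dotv (t *: x) y = t * dotv x y.
Proof. by rewrite dotvC dotvZr (dotvC y). Qed.

Lemma dotvNl x y : dotv (- x) y = - dotv x y.
Proof. by rewrite dotvC dotvNr (dotvC y). Qed.

Lemma dotvBl x y z : dotv (x - y) z = dotv x z - dotv y z.
Proof. by rewrite dotvDl dotvNl. Qed.

Lemma dotv0r x : dotv x 0 = 0.
Proof. by rewrite -(scale0r x) dotvZr mul0r. Qed.

Lemma dotv_delta x (j : 'I_d) : dotv x (delta_mx 0 j) = x 0 j.
Proof.
rewrite /dotv (bigD1 j) //= big1 ?addr0 => [|i ij]; first by rewrite mxE !eqxx mulr1.
by rewrite mxE (negbTE ij) mulr0.
Qed.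

Lemma dotvv_ge0 x : 0 <= dotv x x.
Proof. by apply: sumr_ge0 => i _; rewrite -expr2 sqr_ge0. Qed.

Lemma dotvv_gt0 x : x != 0 -> 0 < dotv x x.
Proof.
move=> x0; rewrite lt_neqAle dotvv_ge0 andbT eq_sym; apply: contra x0 => /eqP h.
apply/eqP/rowP => i; rewrite mxE; apply/eqP.
have /psumr_eq0P : forall j : 'I_d, true -> 0 <= x 0 j * x 0 j.
  by move=> j _; rewrite -expr2 sqr_ge0.
by move=> /(_ h i isT)/eqP; rewrite mulf_eq0 orbb.
Qed.


Lemma continuous_dotv (T : topologicalType) (f g : T -> 'rV[R]_d) :
  continuous f -> continuous g -> continuous (fun t => dotv (f t) (g t)).
Proof.
move=> cf cg; apply: (@continuous_big _ _ +%R 0 xpredT _ T _ (fun i t => f t 0 i * g t 0 i)) => [|i _].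
  exact: add_continuous.
have coordc (h : T -> 'rV[R]_d) : continuous h -> continuous (fun t => h t 0 i).
  move=> ch t.
  apply: (@continuous_comp _ _ _ h (fun u : 'rV[R]_d => u 0 i)); first exact: ch.
  exact: coord_continuous.
by move=> t; apply: continuousM; exact: coordc.
Qed.

Lemma continuous_dotvr y : continuous (dotv y).
Proof. by apply: (@continuous_dotv _ (fun=> y) id) => x //; exact: cst_continuous. Qed.

Lemma closed_dotv_le y (b : R) : closed [set x | dotv y x <= b].
Proof.
apply: (preimage_closed _ (@closed_le _ b)) => x _.
exact: continuous_dotvr.
Qed.

Lemma closed_dotv_ge y (b : R) : closed [set x | b <= dotv y x].
Proof.
apply: (preimage_closed _ (@closed_ge _ b)) => x _.
exact: continuous_dotvr.
Qed.

Lemma rV_norm_leP x (b : R) : 0 <= b ->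
  reflect (forall j, `|x 0 j| <= b) (`|x| <= b).
Proof.
move=> b0; rewrite /Num.norm/= mx_normrE; apply: (iffP idP).
  move=> /bigmax_leP[_ h] j; exact: (h (0, j)).
by move=> h; apply/bigmax_leP; split=> // -[i j] _ /=; rewrite ord1; exact: h.
Qed.

Lemma rV_norm_ltP x (b : R) : 0 < b ->
  reflect (forall j, `|x 0 j| < b) (`|x| < b).
Proof.
move=> b0; rewrite /Num.norm/= mx_normrE; apply: (iffP idP).
  move=> /bigmax_ltP[_ h] j; exact: (h (0, j)).
by move=> h; apply/bigmax_ltP; split=> // -[i j] _ /=; rewrite ord1; exact: h.
Qed.

Lemma norm_coord_le x (j : 'I_d) : `|x 0 j| <= `|x|.
Proof. exact: (elimT (rV_norm_leP x (normr_ge0 x))). Qed.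

Lemma norm_scale_delta_le (t : R) (j : 'I_d) : `|t *: delta_mx 0 j : 'rV[R]_d| <= `|t|.
Proof.
apply/rV_norm_leP => [//|i]; rewrite !mxE eqxx /=.
by case: eqP => _; rewrite ?mulr1 ?mulr0 ?normr0.
Qed.

(** Testing with r e_j and -r e_j bounds each coordinate, as the norm is the maximum norm. Hence the
    polar of a body around 0 is bounded. *)
Lemma norm_le_of_dotv x (r : R) : 0 < r ->
  (forall y, `|y| <= r -> dotv x y <= 1) -> `|x| <= r^-1.
Proof.
move=> r0 h; apply/rV_norm_leP => [|j]; first by rewrite invr_ge0 ltW.
have hd t : `|t| <= r -> t * x 0 j <= 1.
  by move=> tr; rewrite -dotv_delta -dotvZr h // (le_trans (norm_scale_delta_le t j)).
rewrite -[r^-1]mul1r ler_pdivlMr // -[X in _ * X]gtr0_norm // -normrM ler_norml.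
have := hd r; have := hd (- r); rewrite normrN gtr0_norm // lexx.
by move=> /(_ isT) h1 /(_ isT) h2; apply/andP; split; lra.
Qed.

Lemma norm_dotv_le x y : `|dotv x y| <= d%:R * `|x| * `|y|.
Proof.
apply: le_trans (ler_norm_sum _ _ _) _.
rewrite -mulrA mulr_natl -[X in _ *+ X]card_ord -sumr_const; apply: ler_sum => i _.
by rewrite normrM ler_pM ?norm_coord_le.
Qed.

Lemma compact_dotv_max C y : compact C -> C !=set0 ->
  exists2 a, C a & forall b, C b -> dotv y b <= dotv y a.
Proof.
move=> cC C0; have cf := continuous_subspaceT (@continuous_dotvr y) : {within C, continuous dotv y}.
have [a aC h] := compact_EVT_max C0 cC cf.
by exists a => [|b bC]; [exact: set_mem|apply: h; exact: mem_set].
Qed.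

Lemma compact_norm_le C : compact C ->
  exists2 b : R, 0 < b & forall x, C x -> `|x| <= b.
Proof.
move=> /compact_bounded /ex_strict_bound_gt0[b b0 h].
by exists b => // x Cx; apply/ltW/h.
Qed.

Lemma dir_width_ub C y a b : compact C -> C a -> C b ->
  dotv y (a - b) <= dir_width C y.
Proof.
move=> cC Ca Cb; apply: sup_ubound; last by exists a => //; exists b.
have C0 : C !=set0 by exists a.
have [a' _ ha] := compact_dotv_max y cC C0.
have [b' _ hb] := compact_dotv_max (- y) cC C0.
exists (dotv y (a' - b')) => _ [u Cu [v Cv <-]]; rewrite !dotvBr.
by have := ha _ Cu; have := hb _ Cv; rewrite !dotvNl; lra.
Qed.

Lemma dir_width_le C y (w : R) : C !=set0 ->
  (forall a b, C a -> C b -> dotv y (a - b) <= w) -> dir_width C y <= w.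
Proof.
move=> [c Cc] h; apply: ge_sup => [|_ [a Ca [b Cb <-]]]; last exact: h.
by exists (dotv y (c - c)); exists c => //; exists c.
Qed.

Lemma dir_width_attained C y : compact C -> C !=set0 ->
  exists a b, [/\ C a, C b & dir_width C y = dotv y (a - b)].
Proof.
move=> cC C0.
have [a Ca ha] := compact_dotv_max y cC C0.
have [b Cb hb] := compact_dotv_max (- y) cC C0.
exists a, b; split=> //; apply/eqP; rewrite eq_le dir_width_ub // andbT.
apply: dir_width_le => // u v Cu Cv; rewrite !dotvBr.
by have := ha _ Cu; have := hb _ Cv; rewrite !dotvNl; lra.
Qed.

Lemma dir_width_ge0 C y : compact C -> C !=set0 -> 0 <= dir_width C y.
Proof.
by move=> cC [a Ca]; rewrite -(dotv0r y) -(subrr a) dir_width_ub.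
Qed.

Lemma convex_body_cube C : convex_body C ->
  exists x0 r, [/\ C x0, 0 < r & forall x, `|x - x0| <= r -> C x].
Proof.
move=> [_ _ [x0 /nbhs_ballP[e /= e0 he]]]; exists x0, (e / 2); split.
- by apply: he; exact: ballxx.
- by rewrite divr_gt0.
- move=> x hx; apply: he; rewrite -ball_normE /= distrC.
  by apply: le_lt_trans hx _; rewrite ltr_pdivrMr // ltr_pMr // ltr1n.
Qed.

Lemma interior_of_cube C x0 (r : R) : 0 < r -> (forall x, `|x - x0| < r -> C x) ->
  interior C !=set0.
Proof.
move=> r0 h; exists x0; apply/nbhs_ballP; exists r => //= x.
by rewrite -ball_normE /= distrC => /h.
Qed.

Lemma orthogonal_vector k (M : 'M[R]_(k, d)) : (k < d)%N ->
  exists2 u, u != 0 & forall i, dotv (row i M) u = 0.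
Proof.
move=> kd; have K0 : kermx M^T != 0.
  rewrite -mxrank_eq0 mxrank_ker mxrank_tr subn_eq0 -ltnNge.
  exact: leq_ltn_trans (rank_leq_row M) kd.
exists (nz_row (kermx M^T)); first by rewrite nz_row_eq0.
move=> i; have /sub_kermxP h := nz_row_sub (kermx M^T).
by rewrite dotvC dotvE tr_row colE mulmxA h mul0mx mxE.
Qed.

End DotProduct.

(** * Discrete subgroups *)

(** Common ground of a lattice and its dual: discreteness with an explicit radius, for a subgroup of
    any rank. *)
Definition discrete_subgroup (R : realType) d (G : set 'rV[R]_d) :=
  [/\ G 0, (forall x y, G x -> G y -> G (x - y))
    & exists2 e : R, 0 < e & forall x, G x -> `|x| < e -> x = 0].

Section DiscreteSubgroup.
Context {R : realType} {d : nat} {G : set 'rV[R]_d}.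
Hypothesis discG : discrete_subgroup G.
Local Notation intmx := (map_mx (intr : int -> R)).

Lemma discrete_subgroupN x : G x -> G (- x).
Proof. by case: discG => G0 GB _ Gx; rewrite -sub0r; exact: GB. Qed.

Lemma discrete_subgroupD x y : G x -> G y -> G (x + y).
Proof.
by case: (discG) => _ GB _ Gx /discrete_subgroupN Gy; rewrite -[y]opprK; exact: GB.
Qed.

Lemma discrete_subgroup_muln x n : G x -> G (x *+ n).
Proof.
move=> Gx; elim: n => [|n IHn]; first by rewrite mulr0n; case: discG.
by rewrite mulrS; exact: discrete_subgroupD.
Qed.

Lemma discrete_subgroup_mulz x (z : int) : G x -> G (x *~ z).
Proof.
case: z => n Gx; first exact: discrete_subgroup_muln.
by rewrite NegzE mulrNz; apply/discrete_subgroupN/discrete_subgroup_muln.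
Qed.

Lemma discrete_subgroup_mulmx m (z : 'rV[int]_m) (Y : 'M[R]_(m, d)) :
  (forall i, G (row i Y)) -> G (intmx z *m Y).
Proof.
move=> GY; rewrite mulmx_sum_row; elim/big_ind: _ => [|x y|i _].
- by case: discG.
- exact: discrete_subgroupD.
- by rewrite mxE scaler_int; exact: discrete_subgroup_mulz.
Qed.

(* Two points of G lying in the same cell of a fine cubic grid coincide. *)
Lemma discrete_subgroup_finite (b : R) : finite_set (G `&` [set x | `|x| <= b]).
Proof.
case: discG => _ GB [e e0 he].
(* For [|x| <= b] all floors lie between -n and n, so the shift by n gives indices from 0 to 2n. *)
pose n := `|Num.ceil ((b + e) / e)|%N.
pose cell (x : 'rV[R]_d) : 'rV['I_(n + n).+1]_d :=
  \row_j inord (absz (Num.floor (x 0 j / e) + n%:Z)).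
have cellP x j : `|x| <= b -> (cell x ord0 j)%:Z = Num.floor (x 0 j / e) + n%:Z.
  move=> xb; rewrite mxE.
  have nE : (n%:Z)%:~R >= (b + e) / e :> R.
    by apply: le_trans (ceil_ge _) _; rewrite ler_int; exact: lez_abs.
  have /ler_normlP[h1 h2] := le_trans (norm_coord_le x j) xb.
  have f1 : - n%:Z <= Num.floor (x 0 j / e).
    rewrite floor_ge_int rmorphN /= lerNl -mulNr.
    apply: le_trans nE; rewrite ler_pM2r ?invr_gt0 //; lra.
  have f2 : Num.floor (x 0 j / e) <= n%:Z.
    rewrite -(ler_int R); apply: le_trans (floor_le _) _.
    apply: le_trans nE; rewrite ler_pM2r ?invr_gt0 //; lra.
  move: f1 f2; move: (Num.floor _) n {nE cell} => fl n f1 f2.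
  by rewrite inordK ?ltnS; lia.
have injc : {in G `&` [set x | `|x| <= b] &, injective cell}.
  move=> x y /set_mem[Gx xb] /set_mem[Gy yb] xy.
  apply/eqP; rewrite -subr_eq0; apply/eqP/he; first exact: GB.
  apply/rV_norm_ltP => // j; rewrite !mxE.
  have : Num.floor (x 0 j / e) = Num.floor (y 0 j / e).
    by apply: (addIr n%:Z); rewrite -!cellP // xy.
  have := floor_itv (x 0 j / e); have := floor_itv (y 0 j / e).
  set fx := Num.floor _; move=> /andP[y1 y2] /andP[x1 x2] fE; rewrite -fE in y1 y2.
  rewrite intrD in x2 y2.
  have -> : x 0 j - y 0 j = (x 0 j / e - y 0 j / e) * e.
    by field; exact: lt0r_neq0.
  rewrite normrM (gtr0_norm e0) -[ltRHS]mul1r ltr_pM2r // ltr_norml; apply/andP; split; lra.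
by rewrite -(eq_finite_set (inj_card_eq injc)); exact: finite_finset.
Qed.

(* The vectors [j y - floor(j a) B] are bounded elements of G, so two of them coincide. *)
Lemma discrete_subgroup_rational r (B : 'M[R]_(r, d)) y :
  (forall i, G (row i B)) -> G y -> (y <= B)%MS ->
  exists (n : nat) (z : 'rV[int]_r), (0 < n)%N /\ y *+ n = intmx z *m B.
Proof.
move=> GB Gy /submxP[a yE].
pose fl j : 'rV[int]_r := \row_i Num.floor (a 0 i *+ j).
pose f j := y *+ j - intmx (fl j) *m B.
have fin : finite_set (range f).
  apply: sub_finite_set (discrete_subgroup_finite (\sum_i `|row i B|)).
  move=> _ [j _ <-]; split=> /=.
    case: (discG) => _ + _; apply; first exact: discrete_subgroup_muln.
    exact: discrete_subgroup_mulmx.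
  have -> : f j = (a *+ j - intmx (fl j)) *m B.
    by rewrite mulmxBl /f -(scaler_nat j y) -(scaler_nat j a) yE scalemxAl.
  rewrite mulmx_sum_row; apply: le_trans (ler_norm_sum _ _ _) _.
  apply: ler_sum => i _; rewrite normrZ -[leRHS]mul1r ler_wpM2r //.
  rewrite !mxE mulmxnE.
  have := floor_itv (a 0 i *+ j); rewrite intrD => /andP[? ?].
  rewrite ler_norml; apply/andP; split; lra.
have /existsNP[i /existsNP[j /not_implyP[ij neq]]] : ~ (forall i j, f i = f j -> i = j).
  move=> inj; have := infinite_nat.
  by apply; rewrite -(eq_finite_set (@inj_card_eq _ _ setT f _)) // => i j _ _ /inj.
wlog lt_ij : i j ij neq / (i < j)%N.
  move=> H; case: (ltngtP i j) => [|lt_ji|]; first exact: H.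
  - by apply: (H j i) => // ji; exact/neq.
  - by move/neq.
exists (j - i)%N, (fl j - fl i); split; first by rewrite subn_gt0.
rewrite mulrnBr 1?ltnW // map_mxB mulmxBl.
move/eqP: ij; rewrite /f => /eqP ij.
rewrite -[y *+ j](subrK (intmx (fl j) *m B)) -ij addrAC [y *+ i - _ - _]addrAC subrr.
by rewrite sub0r addrC.
Qed.

(** A maximal independent set [B] of rows expresses every row rationally; dividing [B] by a common
    denominator makes the coefficients integral. The rows of [T] may lie outside [G]. *)
Lemma discrete_subgroup_coords m (Y : 'M[R]_(m, d)) : (forall i, G (row i Y)) ->
  exists (E : 'M[int]_(m, \rank Y)) (T : 'M[R]_(\rank Y, d)), Y = intmx E *m T.
Proof.
move=> GY; pose B := rowsub (mxalgebra.maxrankfun Y) Y.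
have GB i : G (row i B) by rewrite row_rowsub.
have YB i : (row i Y <= B)%MS by rewrite eq_maxrowsub row_sub.
have /fin_all_exists[n] : forall i, exists n (z : 'rV[int]_(\rank Y)),
    (0 < n)%N /\ row i Y *+ n = intmx z *m B.
  by move=> i; exact: discrete_subgroup_rational.
move=> /fin_all_exists[z hz].
pose N := (\prod_i n i)%N.
have N0 : (0 < N)%N by apply: prodn_gt0 => i; case: (hz i).
have nN i : (n i %| N)%N by rewrite /N (bigD1 i) //= dvdn_mulr.
exists (\matrix_i (z i *+ (N %/ n i))), (N%:R^-1 *: B).
apply/row_matrixP => i; rewrite -scalemxAr.
apply: (@scalerI _ _ N%:R); first by rewrite pnatr_eq0 -lt0n.
rewrite linearZ /= scalerA divff ?pnatr_eq0 -?lt0n // scale1r.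
rewrite row_mul -map_row rowK scaler_nat -[in LHS](divnK (nN i)) mulnC mulrnA.
have [_ ->] := hz i.
by rewrite raddfMn /= -(scaler_nat (N %/ n i) (_ *m B)) scalemxAl scaler_nat.
Qed.

(* By the Smith normal form the rows of Y are integral combinations of rank Y
   elements of G, which leaves at most 3 ^ rank Y classes modulo 3. *)
Lemma discrete_subgroup_mod3 m (Y : 'M[R]_(m, d)) :
  (forall i, G (row i Y)) -> (3 ^ \rank Y < m)%N ->
  exists i j x, [/\ i != j, G x & row i Y - row j Y = x *+ 3].
Proof.
move=> GY ltm; have [E [T YE]] := discrete_subgroup_coords GY.
have [P Pu [Q Qu [s _ EE]]] := int_Smith_normal_form E.
set D := \matrix_(_, _) _ in EE.
have rm := rank_leq_row Y.
(* [D] is diagonal with [\rank Y] columns, so only the first [\rank Y] entries of a row of [P]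
   matter; [phi] records them modulo 3. *)
pose phi i := [ffun k : 'I_(\rank Y) => inord (absz (P i (widen_ord rm k) %% 3)%Z) : 'I_3].
have /injectivePn[i [j ij phi_ij]] : ~~ injectiveb phi.
  apply: contraL ltm => /injectiveP/leq_card.
  by rewrite card_ffun !card_ord -leqNgt.
pose c : 'rV[int]_m := \row_k (if (k < \rank Y)%N then ((P i k - P j k) %/ 3)%Z else 0).
(* One third of the difference is c D Q T, which equals c P^-1 Y: an integral combination of rows of
   [Y], hence in [G]. *)
exists i, j, (intmx (c *m invmx P) *m Y); split=> //.
  exact: discrete_subgroup_mulmx.
have cD : (row i P - row j P) *m D = (3%:R *: c) *m D.
  apply/rowP => l; rewrite !mxE; apply: eq_bigr => k _; rewrite !mxE.
  have [kl|] := eqVneq (k : nat) l; last by rewrite !mulr0n !mulr0.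
  rewrite kl ltn_ord; congr (_ * _).
  have /ffunP/(_ l) := phi_ij; rewrite !ffunE => /(congr1 val) /=.
  have -> : widen_ord rm l = k by exact/val_inj.
  rewrite !inordK; lia.
have rowE k : row k Y = intmx (row k P *m D *m Q) *m T.
  by rewrite [in LHS]YE row_mul -map_row EE !row_mul.
rewrite !rowE -mulmxBl -map_mxB -!mulmxBl cD.
rewrite [X in _ = _ *m X *+ 3]YE mulmxA -map_mxM EE !mulmxA mulmxKV //.
by rewrite -(scaler_nat 3 (_ *m T)) -!scalemxAl map_mxZ rmorph_nat scalemxAl.
Qed.

End DiscreteSubgroup.

(** * Few short vectors in a low-dimensional lattice *)

Lemma finite_gap (R : realType) (T : Type) (A : set T) (f : T -> R) (w : R) :
  finite_set A -> (forall x, A x -> w < f x) ->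
  exists2 w', w < w' & forall x, A x -> w' <= f x.
Proof.
elim/Pchoice: T => T in A f *.
move=> /finite_seqP[s ->]; elim: s => [|x s IHs] h; first by exists (w + 1) => //; rewrite ltrDl.
have [|w' ww' h'] := IHs; first by move=> y ys; apply: h; rewrite /= inE ys orbT.
exists (Num.min w' (f x)); first by rewrite lt_min ww' h //= inE eqxx.
move=> y /=; rewrite inE => /predU1P[->|ys]; first by rewrite ge_min lexx orbT.
by rewrite ge_min h'.
Qed.

Section LogDimension.
Context {R : realType} {d : nat}.
Implicit Types (G W L C : set 'rV[R]_d) (x y : 'rV[R]_d).

(** The counting shared by both lower bounds: [d <= |W| <= 3 ^ r], the second inequality by
    pigeonhole modulo 3. *)
Lemma log_dim_span G W : (0 < d)%N -> discrete_subgroup G -> finite_set W -> W `<=` G ->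
  (forall y y' x, W y -> W y' -> G x -> y - y' = x *+ 3 -> y = y') ->
  (forall k (M : 'M[R]_(k, d)), (forall i, W (row i M)) ->
     (forall y, W y -> exists i, y = row i M) -> (d <= k)%N) ->
  exists m : nat, (ln 3)^-1 * ln d%:R <= m%:R :> R /\ dim_span_ge W m.
Proof.
move=> d0 discG /finite_seqP[s0 WE] WG W3 Wd.
pose s := undup s0; pose M : 'M[R]_(size s, d) := \matrix_i s`_i.
have Ws y : W y <-> y \in s by rewrite WE mem_undup.
have WM i : W (row i M) by rewrite rowK; apply/Ws/mem_nth.
exists (\rank M); split; last by exists (size s), M.
have ds : (d <= size s)%N.
  apply: Wd WM _ => y /Ws ys; have ys' : (index y s < size s)%N by rewrite index_mem.
  by exists (Ordinal ys'); rewrite rowK nth_index.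
have s3 : (size s <= 3 ^ \rank M)%N.
  rewrite leqNgt; apply/negP => /(discrete_subgroup_mod3 discG).
  case=> [i|i [j [x [/negP ij Gx /W3 MM]]]]; first exact/WG/WM.
  apply: ij; have /eqP := MM (WM _) (WM _) Gx.
  by rewrite !rowK nth_uniq ?undup_uniq.
have ln3 : 0 < ln 3 :> R by rewrite ln_gt0 // ltr1n.
rewrite mulrC ler_pdivrMr // mulr_natl -lnXn //.
rewrite ler_ln ?posrE ?ltr0n // ?exprn_gt0 //.
by rewrite -natrX ler_nat (leq_trans ds).
Qed.

Lemma lattice_discrete L : is_lattice L -> discrete_subgroup L.
Proof.
case=> L0 LB /nbhs_ballP[e /= e0 he] _; split=> //; exists e => // x Lx xe.
by apply: he => //; rewrite -ball_normE /= sub0r normrN.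
Qed.

(** A dual vector short compared with the lattice vectors in [M] has integral products of absolute
    value below 1 with them. These products vanish, and [M] has full column rank. *)
Lemma dual_lattice_discrete L : is_lattice L -> discrete_subgroup (dual_lattice L).
Proof.
case=> L0 LB _ [k [M [LM rM]]]; split.
- by move=> x _; exists 0; rewrite dotv0r.
- move=> x y Lx Ly z Lz; have [a xa] := Lx z Lz; have [b yb] := Ly z Lz.
  by exists (a - b); rewrite dotvBr xa yb intrD rmorphN.
pose b := 1 + d%:R * \sum_i `|row i M|.
have sum0 : 0 <= \sum_i `|row i M| by apply: sumr_ge0.
have b0 : 0 < b by rewrite ltr_pwDl // mulr_ge0.
exists b^-1; first by rewrite invr_gt0.
move=> y Ly yb.
have yM i : dotv (row i M) y = 0.
  have [z zE] := Ly _ (LM i).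
  have : `|z%:~R| < 1 :> R.
    rewrite -zE; apply: le_lt_trans (norm_dotv_le _ _) _.
    rewrite -[ltRHS](mulVf (lt0r_neq0 b0)).
    rewrite mulrC; apply: ltr_pM => //.
    rewrite /b addrC ltr_pwDr // ler_wpM2l // (bigD1 i) //= lerDl; exact: sumr_ge0.
  by rewrite zE -intr_norm -[1]/(1%:~R) ltr_int => z1; have -> : z = 0 by lia.
have /row_fullP[N NM] : row_full M by rewrite /row_full eqn_leq rank_leq_col.
apply: trmx_inj; rewrite trmx0 -[y^T]mul1mx -NM -mulmxA.
suff -> : M *m y^T = 0 by rewrite mulmx0.
by apply/row_matrixP => i; apply/rowP => j; rewrite row_mul !ord1 -dotvE yM !mxE.
Qed.

(** The points x0 + r e_j and x0 - r e_j of [C] force a width of at least 2 r |y_j|. So only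
    finitely many dual vectors have bounded width. *)
Lemma norm_le_dir_width C x0 (r : R) y : compact C -> 0 < r ->
  (forall x, `|x - x0| <= r -> C x) -> `|y| <= dir_width C y / (r *+ 2).
Proof.
move=> cC r0 hr.
have Cx0 : C x0 by apply: hr; rewrite subrr normr0 ltW.
have w0 := dir_width_ge0 y cC (ex_intro _ x0 Cx0).
have r20 : 0 < r *+ 2 by rewrite pmulrn_lgt0.
apply/rV_norm_leP => [|j]; first by rewrite divr_ge0 // ltW.
have hC t : `|t| <= r -> C (x0 + t *: delta_mx 0 j).
  by move=> tr; apply: hr; rewrite addrC addKr (le_trans (norm_scale_delta_le t j)).
have Cp : C (x0 + r *: delta_mx 0 j) by apply: hC; rewrite gtr0_norm.
have Cm : C (x0 + (- r) *: delta_mx 0 j) by apply: hC; rewrite normrN gtr0_norm.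
rewrite ler_pdivlMr // -[r *+ 2]gtr0_norm // -normrM ler_norml; apply/andP; split.
  have := dir_width_ub y cC Cm Cp.
  rewrite !(dotvBr, dotvDr, dotvZr, dotv_delta); lra.
have := dir_width_ub y cC Cp Cm.
rewrite !(dotvBr, dotvDr, dotvZr, dotv_delta); lra.
Qed.

Lemma dir_widthZ C y (t : R) : compact C -> C !=set0 -> 0 <= t ->
  dir_width C (t *: y) = t * dir_width C y.
Proof.
move=> cC C0 t0; have [a [b [Ca Cb wE]]] := dir_width_attained y cC C0.
apply/eqP; rewrite eq_le; apply/andP; split.
  apply: dir_width_le => // u v Cu Cv; rewrite dotvZl ler_wpM2l //.
  exact: dir_width_ub.
by rewrite wE -dotvZl; exact: dir_width_ub.
Qed.

Lemma dir_width_triangle C y y' : compact C -> C !=set0 ->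
  dir_width C (y - y') <= dir_width C y + dir_width C y'.
Proof.
move=> cC C0; apply: dir_width_le => // a b Ca Cb.
have := dir_width_ub y cC Ca Cb; have := dir_width_ub y' cC Cb Ca.
rewrite !(dotvBr, dotvBl); lra.
Qed.

Lemma lattice_width_le L C y : compact C -> C !=set0 -> dual_lattice L y -> y != 0 ->
  lattice_width L C <= dir_width C y.
Proof.
move=> cC C0 Ly y0; apply: ge_inf; last by exists y.
by exists 0 => _ [z _ <-]; exact: dir_width_ge0.
Qed.

Lemma finite_dir_width_le L C (w : R) : is_lattice L -> convex_body C ->
  finite_set [set y | dual_lattice L y /\ dir_width C y <= w].
Proof.
move=> /dual_lattice_discrete discL CB; have [cC _ _] := CB.
have [x0 [r [Cx0 r0 hr]]] := convex_body_cube CB.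
apply: sub_finite_set (discrete_subgroup_finite discL (w / (r *+ 2))) => y [Ly yw].
split=> //=; apply: le_trans (norm_le_dir_width y cC r0 hr) _.
by rewrite ler_wpM2r // invr_ge0 ltW // pmulrn_lgt0.
Qed.

End LogDimension.

(** * Reduced bodies *)

Section ReducedBodies.
Context {R : realType} {d : nat} {L C : set 'rV[R]_d}.
Hypotheses (latL : is_lattice L) (CB : convex_body C).

Lemma lattice_width_ge0 : 0 <= lattice_width L C.
Proof.
have [cC _ [c /interior_subset Cc]] := CB.
rewrite /lattice_width; set A := (X in inf X).
(* The infimum of the empty set is 0 by convention. *)
have [A0|/set0P[z Az]] := eqVneq A set0; first by rewrite A0 inf0.
by apply: lb_le_inf; [exists z|move=> _ [y _ <-]; apply: dir_width_ge0 => //; exists c].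
Qed.

Lemma width_directions_finite : finite_set (width_directions L C).
Proof.
apply: sub_finite_set (finite_dir_width_le (lattice_width L C) latL CB).
by move=> y [Ly [_ wy]]; split=> //; rewrite wy.
Qed.

(** Finitely many dual vectors have width at most w + 1, so those outside the width directions leave
    a gap; all remaining vectors exceed w by more than 1. *)
Lemma width_directions_gap : exists2 w' : R, lattice_width L C < w' &
  forall y, dual_lattice L y -> y != 0 -> ~ width_directions L C y -> w' <= dir_width C y.
Proof.
have [cC _ [c /interior_subset Cc]] := CB; set w := lattice_width L C.
pose A := [set y | dual_lattice L y /\ dir_width C y <= w + 1] `&`
  [set y | y != 0 /\ ~ width_directions L C y].
have finA : finite_set A.
  apply: finite_setIl; exact: finite_dir_width_le.
have [|w1 w1w h] := @finite_gap _ _ A (dir_width C) w finA.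
  move=> y [[Ly _] [y0 nWy]]; rewrite lt_neqAle lattice_width_le ?andbT //; last by exists c.
  by apply/eqP => wE; apply: nWy.
exists (Num.min w1 (w + 1)); first by rewrite lt_min w1w ltrDl ltr01.
move=> y Ly y0 nWy; rewrite ge_min; case: (leP (dir_width C y) (w + 1)) => [yw|/ltW ->].
  by rewrite h.
by rewrite orbT.
Qed.

(** The triangle inequality bounds the width along x by 2w/3, yet it is at least w if x is nonzero.
    This forces w = 0, impossible since [C] contains a cube. *)
Lemma width_directions_mod3 y y' x : width_directions L C y -> width_directions L C y' ->
  dual_lattice L x -> y - y' = x *+ 3 -> y = y'.
Proof.
have [cC _ [c /interior_subset Cc]] := CB; have C0 : C !=set0 by exists c.
move=> [Ly [y0 wy]] [Ly' [_ wy']] Lx yx.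
apply/eqP; apply: contraT => yy'.
have x0 : x != 0 by apply: contra_neq yy' => x0; apply/eqP; rewrite -subr_eq0 yx x0 mul0rn.
have := lattice_width_le cC C0 Lx x0.
have := dir_width_triangle y y' cC C0.
rewrite yx -(scaler_nat 3 x) dir_widthZ // wy wy' => h1 h2.
have [x1 [r [_ r0 hr]]] := convex_body_cube CB.
have := norm_le_dir_width y cC r0 hr; rewrite wy.
have -> : lattice_width L C = 0.
  by apply/eqP; rewrite eq_le lattice_width_ge0 andbT; lra.
by rewrite mul0r normr_le0 (negbTE y0).
Qed.

(* If k < d, some hyperplane u.x = const passes through an interior point x0 and
   through a maximizer of every width direction. Cutting off a thin slice of C
   parallel to it preserves those maximizers; the slice is so thin that a homothet
   of C survives, keeping the other directions wide. *)
Lemma reduced_many_width_directions k (M : 'M[R]_(k, d)) : lattice_reduced L C ->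
  (forall i, width_directions L C (row i M)) ->
  (forall y, width_directions L C y -> exists i, y = row i M) -> (d <= k)%N.
Proof.
move=> redC WM Mall; rewrite leqNgt; apply/negP => kd.
have [cC convC _] := CB.
have [x0 [r [Cx0 r0 hr]]] := convex_body_cube CB.
have C0 : C !=set0 by exists x0.
have /fin_all_exists[a ha] : forall i, exists a, C a /\
    forall b, C b -> dotv (row i M) b <= dotv (row i M) a.
  by move=> i; have [a Ca h] := compact_dotv_max (row i M) cC C0; exists a.
have [u u0 hu] := orthogonal_vector (\matrix_i (a i - x0)) kd.
have {}hu i : dotv u (a i) = dotv u x0.
  by have := hu i; rewrite rowK dotvC dotvBr => /eqP; rewrite subr_eq0 => /eqP.
have [e Ce he] := compact_dotv_max u cC C0.
set h := dotv u e in he; set b := dotv u x0 in hu.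
have nu : 0 < `|u| by rewrite normr_gt0.
have bh : b < h.
  have : C (x0 + (r / `|u|) *: u).
    apply: hr; rewrite addrC addKr normrZ normrM normfV normr_id gtr0_norm //.
    by rewrite divfK ?gt_eqF.
  move=> /he; rewrite dotvDr dotvZr; apply: lt_le_trans.
  by rewrite ltrDl mulr_gt0 ?dotvv_gt0 ?divr_gt0.
have w0 := lattice_width_ge0; have [w' ww' hw'] := width_directions_gap.
set w := lattice_width L C in w0 ww' hw'.
have w'0 : 0 < w' by lra.
(* With this t, (1 - t) w' is the mean of w and w', so a homothet of ratio 1 - t keeps the other
   directions wider than w. *)
pose t := (w' - w) / (w' *+ 2).
have w't : w' *+ 2 * t = w' - w.
  by rewrite /t mulrC divfK // gt_eqF // pmulrn_lgt0.
have t0 : 0 < t by rewrite divr_gt0 ?subr_gt0 ?pmulrn_lgt0.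
have t1 : t < 1 by rewrite ltr_pdivrMr ?pmulrn_lgt0 // mul1r; lra.
(* The bound is the maximum of u over the homothet of [C] with centre [x0] and ratio 1 - t. *)
pose C' := C `&` [set x | dotv u x <= h - t * (h - b)].
have homC' z : C z -> C' (t *: x0 + (1 - t) *: z).
  move=> Cz; split; first by apply: convC => //; apply: ltW.
  rewrite /= dotvDr !dotvZr -/b; have := he z Cz; nra.
have C'C : C' `<=` C by move=> x [].
have aC' i : C' (a i).
  split; first by case: (ha i).
  by rewrite /= hu; nra.
have cC' : compact C' by apply: compact_closedI => //; exact: closed_dotv_le.
have C'0 : C' !=set0 by exists (t *: x0 + (1 - t) *: x0); exact: homC'.
have C'B : convex_body C'.
  split=> //.
    move=> x y s [Cx ux] [Cy uy] s0 s1; split; first exact: convC.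
    rewrite /= in ux uy *; rewrite dotvDr !dotvZr; nra.
  apply: (@interior_of_cube _ _ _ x0 ((1 - t) * r)); first by rewrite mulr_gt0 ?subr_gt0.
  move=> x xr; have -> : x = t *: x0 + (1 - t) *: (x0 + (1 - t)^-1 *: (x - x0)).
    rewrite scalerDr scalerA divff ?gt_eqF ?subr_gt0 // scale1r addrA -scalerDl.
    by rewrite [t + _]addrC subrK scale1r addrC subrK.
  apply: homC'; apply: hr; rewrite addrC addKr normrZ gtr0_norm ?invr_gt0 ?subr_gt0 //.
  by rewrite mulrC ler_pdivrMr ?subr_gt0 // mulrC ltW.
apply: (redC C' C'B).
  split=> // /(_ e Ce)[_ /=]; rewrite -/h; nra.
have W' y : dual_lattice L y -> y != 0 -> w <= dir_width C' y.
  move=> Ly y0; have [Wy|/(hw' y Ly y0) w'y] := pselect (width_directions L C y).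
    have [_ [_ wy]] := Wy; have [i yE] := Mall _ Wy.
    (* Since -y is a width direction too, its maximizer a_j minimizes y over [C]; both a_i and a_j
       survive in [C']. *)
    have [|j yE'] := Mall (- y).
      split; first exact: discrete_subgroupN (dual_lattice_discrete latL) _ Ly.
      rewrite oppr_eq0 y0; split=> //; rewrite -wy.
      apply/eqP; rewrite eq_le; apply/andP; split; apply: dir_width_le => // p q Cp Cq.
        by rewrite dotvNl -dotvNr opprB; exact: dir_width_ub.
      by rewrite -[dotv y _]opprK -dotvNl -dotvNr opprB; exact: dir_width_ub.
    have [p [q [Cp Cq]]] := dir_width_attained y cC C0; rewrite wy -/w => ->.
    apply: le_trans (dir_width_ub y cC' (aC' i) (aC' j)).
    have [_ /(_ p Cp)] := ha i; have [_ /(_ q Cq)] := ha j.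
    rewrite -yE -yE' !dotvNl !dotvBr; lra.
  have [p [q [Cp Cq wE]]] := dir_width_attained y cC C0.
  have := dir_width_ub y cC' (homC' _ Cp) (homC' _ Cq).
  rewrite opprD addrACA subrr add0r -scalerBr dotvZr -wE; nra.
have sub y : dir_width C' y <= dir_width C y.
  apply: dir_width_le => // p q /C'C Cp /C'C Cq; exact: dir_width_ub.
(* Without nonzero dual vectors both widths are the infimum of the empty set. *)
have [[y [Ly y0]]|D0] := pselect (exists y, dual_lattice L y /\ y != 0); last first.
  rewrite /lattice_width; congr (inf _); apply/seteqP.
  by split=> z [y Dy _]; case: D0; exists y.
apply/eqP; rewrite eq_le; apply/andP; split.
  apply: lb_le_inf; first by exists (dir_width C y); exists y.
  by move=> _ [z [Lz z0] <-]; apply: le_trans (sub z); exact: lattice_width_le.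
apply: lb_le_inf; first by exists (dir_width C' y); exists y.
by move=> _ [z [Lz z0] <-]; exact: W'.
Qed.

Lemma reduced_log_dim : (0 < d)%N -> lattice_reduced L C ->
  exists m : nat, (ln 3)^-1 * ln d%:R <= m%:R :> R /\
    dim_span_ge (width_directions L C) m.
Proof.
move=> d0 redC; apply: log_dim_span d0 (dual_lattice_discrete latL) _ _ _ _.
- exact: width_directions_finite.
- by move=> y [].
- exact: width_directions_mod3.
- by move=> k M; exact: reduced_many_width_directions.
Qed.

End ReducedBodies.

(** * Separation *)

Lemma finite_argmin (R : realType) (T : Type) (A : set T) (f : T -> R) :
  finite_set A -> A !=set0 -> exists2 x, A x & forall y, A y -> f x <= f y.
Proof.
elim/Pchoice: T => T in A f *.
move=> /finite_seqP[s ->] [x0 /= x0s].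
have /(_ x0 x0s)[x xs h] : forall z, z \in s -> exists2 x, x \in s &
    forall y, y \in s -> f x <= f y.
  elim: s {x0s} => [//|x [|z' s] IHs] z _.
    by exists x; rewrite ?mem_head // => y; rewrite inE => /eqP ->.
  have [m ms hm] := IHs z' (mem_head _ _).
  have [xm|mx] := leP (f x) (f m).
    exists x; rewrite ?mem_head // => y; rewrite inE => /predU1P[->//|/hm].
    exact: le_trans.
  exists m; first by rewrite inE ms orbT.
  by move=> y; rewrite inE => /predU1P[->|/hm//]; exact: ltW.
by exists x.
Qed.

Section Separation.
Context {R : realType} {d : nat}.
Implicit Types (K C : set 'rV[R]_d) (p q u v w x : 'rV[R]_d).

(* u points from the nearest point of K to p. *)
Lemma strict_separation K p : compact K -> Defs.convex_set K -> K !=set0 -> ~ K p ->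
  exists u, forall k, K k -> dotv u k < dotv u p.
Proof.
move=> cK convK K0 nKp.
have cf : continuous (fun x => dotv (x - p) (x - p)).
  have cB : continuous (fun x => x - p).
    by move=> x; apply: continuousB => //; exact: cst_continuous.
  exact: continuous_dotv.
have [q /set_mem Kq hq] := compact_EVT_min K0 cK (continuous_subspaceT cf).
have u0 : 0 < dotv (p - q) (p - q).
  by apply: dotvv_gt0; rewrite subr_eq0; apply/eqP => pq; apply: nKp; rewrite pq.
exists (p - q) => k Kk.
have -> : dotv (p - q) k = dotv (p - q) q + dotv (p - q) (k - q) by rewrite -dotvDr subrKC.
have -> : dotv (p - q) p = dotv (p - q) q + dotv (p - q) (p - q) by rewrite -dotvDr subrKC.
rewrite ltrD2l; apply: le_lt_trans u0; rewrite leNgt; apply/negP => A0.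
set A := dotv (p - q) (k - q) in A0.
pose B := dotv (k - q) (k - q); have B0 : 0 <= B := dotvv_ge0 _.
have AB : 0 < A + B by lra.
(* Moving from q towards k by this fraction would bring it strictly closer to p. The denominator is
   positive and s is at most 1, so the moved point stays in [K]. *)
pose s := A / (A + B); have sAB : s * (A + B) = A by rewrite divfK // gt_eqF.
have s0 : 0 < s by rewrite divr_gt0.
have s1 : s <= 1 by rewrite ler_pdivrMr // mul1r lerDl.
have := hq _ (mem_set (convK k q s Kk Kq (ltW s0) s1)) => /=.
have -> : s *: k + (1 - s) *: q - p = s *: (k - q) - (p - q).
  by apply/rowP => j; rewrite !mxE; ring.
rewrite -opprB [dotv (- _) _]dotvNl dotvNr opprK.
have -> : dotv (s *: (k - q) - (p - q)) (s *: (k - q) - (p - q)) =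
    s * (s * B) - 2 * (s * A) + dotv (p - q) (p - q).
  rewrite /A /B; move: (k - q) (p - q) => g e.
  by rewrite !dotvBr !dotvBl !dotvZr !dotvZl (dotvC g e); ring.
have -> : s * B = A - s * A by move: sAB; rewrite mulrDr; lra.
have := mulr_gt0 s0 A0; have := mulr_gt0 s0 (mulr_gt0 s0 A0); lra.
Qed.

Lemma bounded_set_of_le (C : set 'rV[R]_d) (b : R) : (forall x, C x -> `|x| <= b) -> bounded_set C.
Proof.
move=> h; exists b; split; first exact: num_real.
by move=> y yb x Cx; apply: le_trans (h x Cx) (ltW yb).
Qed.

(* The functional maximizing u.p over the polar body of K. *)
Lemma support_functional K p (r : R) : compact K -> Defs.convex_set K -> 0 < r ->
  (forall x, `|x| <= r -> K x) -> (forall s, 1 < s -> ~ K (s *: p)) ->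
  exists u, (forall k, K k -> dotv u k <= 1) /\ 1 <= dotv u p.
Proof.
move=> cK convK r0 hr hp.
have K0 : K 0 by apply: hr; rewrite normr0 ltW.
pose P := \bigcap_(k in K) [set u | dotv k u <= 1].
have cP : compact P.
  apply: bounded_closed_compact; last by apply: closed_bigI => k _; exact: closed_dotv_le.
  apply: (@bounded_set_of_le _ r^-1) => u Pu.
  by apply: norm_le_of_dotv => // k kr; rewrite dotvC; exact/Pu/hr.
have P0 : P !=set0 by exists 0 => k _ /=; rewrite dotv0r.
have [u Pu hu] := compact_dotv_max p cP P0.
exists u; split; first by move=> k Kk; rewrite dotvC; exact: Pu.
rewrite dotvC leNgt; apply/negP => s1; set s := dotv p u in hu s1.
have s0 : 0 <= s by rewrite -(dotv0r p); apply: hu => k _ /=; rewrite dotv0r.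
(* If s < 1, the point p / s' lies outside [K]. A functional separating it, rescaled to take the
   value s' at p, lies in the polar and beats the maximum s. *)
pose s' := (1 + s) / 2; have s'0 : 0 < s' by rewrite divr_gt0 //; lra.
have ss' : s < s' by rewrite ltr_pdivlMr //; lra.
have s'1 : s' < 1 by rewrite ltr_pdivrMr //; lra.
have [v hv] : exists v, forall k, K k -> dotv v k < dotv v (s'^-1 *: p).
  apply: strict_separation => //; first by exists 0.
  by apply: hp; rewrite invf_gt1.
have vp : 0 < dotv v p.
  have := hv _ K0; rewrite dotv0r dotvZr pmulr_rgt0 // invr_gt0 //.
have : P ((s' / dotv v p) *: v).
  move=> k Kk /=; rewrite dotvZr (dotvC k) mulrAC ler_pdivrMr // mul1r.
  by have := hv k Kk; rewrite dotvZr ltr_pdivlMl // => /ltW.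
by move=> /hu; rewrite dotvZr (dotvC p) divfK ?gt_eqF // leNgt ss'.
Qed.

Lemma line_max C x v : compact C -> C x -> v != 0 ->
  exists m : R, [/\ 0 <= m, C (x + m *: v) & forall t, C (x + t *: v) -> t <= m].
Proof.
move=> cC Cx v0; have nv : 0 < `|v| by rewrite normr_gt0.
pose f (t : R) := x + t *: v.
have cf : continuous f.
  move=> t; apply: cvgD; first exact: cvg_cst.
  by apply: cvgZr_tmp; exact: cvg_id.
have [b b0 hb] := compact_norm_le cC.
have clA : closed (f @^-1` C).
  by apply: preimage_closed => [t _|]; [exact: cf|exact: compact_closed cC].
have cA : compact (f @^-1` C).
  apply: (subclosed_compact clA (@segment_compact _ (- (b *+ 2 / `|v|)) (b *+ 2 / `|v|))).
  move=> t /= Ct; rewrite in_itv /= -ler_norml ler_pdivlMr // -normrZ.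
  have -> : t *: v = f t - x by rewrite /f addrC addKr.
  apply: le_trans (ler_normB _ _) _; rewrite mulr2n; exact: lerD (hb _ Ct) (hb _ Cx).
have A0 : f @^-1` C !=set0 by exists 0; rewrite /= /f scale0r addr0.
have cid : {within f @^-1` C, continuous (@idfun R)} by apply: continuous_subspaceT => t; exact: cvg_id.
have [m /set_mem Cm hm] := compact_EVT_max A0 cA cid.
exists m; split=> //; last by move=> t Ct; apply: hm; exact/mem_set.
by apply: hm; apply/mem_set; rewrite /= /f scale0r addr0.
Qed.

(** A convex [C] contains a translate of the segment from 0 to x exactly when x lies in this
    symmetric set, so segment lengths in [C] are read off along rays from 0. *)
Definition difference_body C : set 'rV[R]_d := [set a - b | a in C & b in C].

Lemma difference_body_compact C : compact C -> compact (difference_body C).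
Proof.
move=> cC; pose f (x : 'rV[R]_d * 'rV[R]_d) := x.1 - x.2.
have cf : continuous f.
  by move=> x; apply: (@continuousB _ _ _ fst snd); [exact: cvg_fst|exact: cvg_snd].
have -> : difference_body C = f @` (C `*` C).
  apply/seteqP; split=> [_ [a Ca [b Cb <-]]|_ [[a b] [/= Ca Cb] <-]].
    by exists (a, b).
  by exists a => //; exists b.
apply: continuous_compact; first exact: continuous_subspaceT.
exact: compact_setX.
Qed.

Lemma difference_body_convex C : Defs.convex_set C -> Defs.convex_set (difference_body C).
Proof.
move=> convC _ _ t [a Ca [b Cb <-]] [a' Ca' [b' Cb' <-]] t0 t1.
exists (t *: a + (1 - t) *: a'); first exact: convC.
exists (t *: b + (1 - t) *: b'); first exact: convC.
by rewrite !scalerBr opprD addrACA.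
Qed.

Lemma difference_bodyN C v : difference_body C v -> difference_body C (- v).
Proof. by case=> a Ca [b Cb <-]; exists b => //; exists a => //; rewrite opprB. Qed.

End Separation.

(** * Complete bodies *)

(** Among the lattice vectors of norm at most |v| having [v] as a positive multiple, finitely many
    by discreteness, a shortest one is primitive. *)
Lemma primitive_multiple (R : realType) d (L : set 'rV[R]_d) v : discrete_subgroup L ->
  L v -> v != 0 -> exists w (n : R), [/\ primitive_vec L w, 1 <= n & v = n *: w].
Proof.
move=> discL Lv v0.
pose A := (L `&` [set x | `|x| <= `|v|]) `&` [set w | w != 0 /\ exists n : R, 0 < n /\ v = n *: w].
have finA : finite_set A by apply: finite_setIl; exact: discrete_subgroup_finite.
have [|w [[Lw /= wv] [w0 [n [n0 vE]]]] hw] := @finite_argmin _ _ A (fun x => `|x|) finA.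
  by exists v; split=> //=; split=> //; exists 1; rewrite scale1r.
exists w, n; split=> //.
  split=> // s s0 s1 Lsw.
  have sw : `|s *: w| < `|w|.
    by rewrite normrZ gtr0_norm // -[ltRHS]mul1r ltr_pM2r // normr_gt0.
  suff /hw : A (s *: w) by rewrite leNgt sw.
  split; first by split=> //=; exact: le_trans (ltW sw) wv.
  split=> /=; first by rewrite scaler_eq0 negb_or gt_eqF.
  by exists (n / s); rewrite scalerA divfK ?gt_eqF // divr_gt0.
by move: wv; rewrite vE normrZ (gtr0_norm n0) -[leLHS]mul1r ler_pM2r // normr_gt0.
Qed.

Section CompleteBodies.
Context {R : realType} {d : nat} {L : set 'rV[R]_d}.
Hypothesis latL : is_lattice L.
Implicit Types (C : set 'rV[R]_d).

(** If [C] has norm at most m and nonzero lattice vectors have norm at least e, lattice lengths are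
    at most 2m / e; hence the supremum is finite. *)
Lemma lattice_diam_ub C a b w t : compact C -> C a -> C b -> lattice_segment L a b w t ->
  t <= lattice_diam L C.
Proof.
move=> cC Ca Cb seg; apply: sup_ubound; last by exists a, b, w.
have [_ _ [e e0 he]] := lattice_discrete latL.
have [m m0 hm] := compact_norm_le cC.
exists (m *+ 2 / e) => s [p [q [z [Cp Cq [[Lz z0 _] s0 pq]]]]].
rewrite ler_pdivlMr //.
have ez : e <= `|z| by rewrite leNgt; apply: contra z0 => /(he z Lz) ->.
apply: le_trans (ler_wpM2l s0 ez) _; rewrite -[X in X * _]ger0_norm // -normrZ -pq.
apply: le_trans (ler_normB _ _) _; rewrite mulr2n; exact: lerD (hm _ Cq) (hm _ Cp).
Qed.

Hypothesis d0 : (0 < d)%N.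

Lemma lattice_primitive : exists w, primitive_vec L w.
Proof.
have [_ _ _ [k [M [LM rM]]]] := latL.
have [i Mi0] : exists i, row i M != 0.
  apply/existsP; apply: contraLR rM => /existsPn M0.
  suff -> : M = 0 by rewrite mxrank0 -ltnNge.
  by apply/row_matrixP => i; rewrite row0; apply/eqP; rewrite -[_ == _]negbK M0.
by have [w [n [Pw _ _]]] := primitive_multiple (lattice_discrete latL) (LM i) Mi0; exists w.
Qed.

Lemma lattice_diam_le C (D : R) : C !=set0 ->
  (forall a b w t, C a -> C b -> lattice_segment L a b w t -> t <= D) ->
  lattice_diam L C <= D.
Proof.
move=> [c Cc] h; apply: ge_sup; last first.
  by move=> t [a [b [w [Ca Cb seg]]]]; exact: h Ca Cb seg.
have [w Pw] := lattice_primitive.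
by exists 0, c, c, w; split=> //; split=> //; rewrite subrr scale0r.
Qed.

Context {C : set 'rV[R]_d}.
Hypothesis CB : convex_body C.
Local Notation D := (lattice_diam L C).
Local Notation K := (difference_body C).

(** [diameter_directions] contains all nonzero lattice multiples of its members; the primitive
    representatives form a finite set that can be counted. *)
Definition primitive_diameters : set 'rV[R]_d :=
  [set w | primitive_vec L w /\ K (D *: w)].

Lemma lattice_diam_gt0 : 0 < D.
Proof.
have [cC _ _] := CB; have [x0 [r [Cx0 r0 hr]]] := convex_body_cube CB.
have [w Pw] := lattice_primitive.
have w0 : 0 < `|w| by case: Pw => _ w0 _; rewrite normr_gt0.
apply: (@lt_le_trans _ _ (r / `|w|)); first by rewrite divr_gt0.
apply: (@lattice_diam_ub _ x0 (x0 + (r / `|w|) *: w) w) => //.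
  apply: hr; rewrite addrC addKr normrZ normrM normfV normr_id gtr0_norm //.
  by rewrite divfK ?gt_eqF.
by split=> //; [rewrite divr_ge0 ?ltW|rewrite addrC addKr].
Qed.

Lemma difference_body_le w t : primitive_vec L w -> K (t *: w) -> t <= D.
Proof.
move=> Pw [b Cb [a Ca ab]]; have [cC _ _] := CB.
have [t0|/ltW t0] := leP 0 t; last exact: le_trans t0 (ltW lattice_diam_gt0).
by apply: (lattice_diam_ub (w := w) cC Ca Cb); split.
Qed.

Lemma primitive_diameters_finite : finite_set primitive_diameters.
Proof.
have [cC _ _] := CB; have [b b0 hb] := compact_norm_le (difference_body_compact cC).
have D0 := lattice_diam_gt0.
apply: sub_finite_set (discrete_subgroup_finite (lattice_discrete latL) (b / D)) => w [[Lw _ _] Kw].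
by split=> //=; rewrite ler_pdivlMr // mulrC -[X in X * _]gtr0_norm // -normrZ hb.
Qed.

(** Only finitely many primitive vectors admit t > D / 2. Each has a longest multiple in the
    difference body, shorter than D outside [primitive_diameters]; negating the lengths makes
    [finite_gap] applicable. *)
Lemma primitive_diameters_gap : exists2 D2 : R, D2 < D &
  forall w t, primitive_vec L w -> ~ primitive_diameters w -> K (t *: w) -> t <= D2.
Proof.
have [cC _ [c /interior_subset Cc]] := CB; have cK := difference_body_compact cC.
have [b b0 hb] := compact_norm_le cK; have D0 := lattice_diam_gt0.
have K0 : K 0 by exists c => //; exists c => //; rewrite subrr.
pose len w := sup [set t | K (t *: w)].
have lenP w : w != 0 -> K (len w *: w) /\ forall t, K (t *: w) -> t <= len w.
  move=> w0; have [m [_]] := line_max cK K0 w0; rewrite add0r => Km hm.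
  have {}hm t : K (t *: w) -> t <= m by move=> Kt; apply: hm; rewrite add0r.
  suff -> : len w = m by [].
  apply/eqP; rewrite eq_le; apply/andP; split; first by apply: ge_sup => //; exists m.
  by apply: sup_ubound => //; exists m.
pose A := (L `&` [set x | `|x| <= b / (D / 2)]) `&`
  [set w | primitive_vec L w /\ ~ primitive_diameters w].
have finA : finite_set A.
  by apply: finite_setIl; exact: discrete_subgroup_finite (lattice_discrete latL) _.
have [|D' DD' h] := @finite_gap _ _ A (fun w => - len w) (- D) finA.
  move=> w [_ [Pw nW]]; rewrite ltrN2 lt_neqAle.
  have [Kl hl] := lenP w (let: And3 _ w0 _ := Pw in w0).
  rewrite (difference_body_le Pw) // andbT; apply/eqP => lD; apply: nW.
  by split; rewrite -?lD.
exists (Num.max (- D') (D / 2)); first by rewrite gt_max; apply/andP; split; lra.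
move=> w t Pw nW Kt; rewrite le_max; case: (leP t (D / 2)) => [_|Dt]; first by rewrite orbT.
have [Lw w0 _] := Pw; have [_ /(_ t Kt) tl] := lenP w w0.
rewrite lerNr (le_trans (h w _)) ?lerN2 //; split=> //; split=> //=.
rewrite ler_pdivlMr ?divr_gt0 // mulrC.
have t0 : 0 < t by apply: lt_trans Dt; rewrite divr_gt0.
by apply: le_trans (hb _ Kt); rewrite normrZ gtr0_norm // ler_wpM2r // ltW.
Qed.

(** The midpoint of D w and -D w' is (3/2) D x, where x is n >= 1 times a primitive z. So [C] would
    contain a segment along z of lattice length at least 3D / 2. *)
Lemma primitive_diameters_mod3 w w' x : primitive_diameters w -> primitive_diameters w' ->
  L x -> w - w' = x *+ 3 -> w = w'.
Proof.
have [_ convC _] := CB; have D0 := lattice_diam_gt0.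
move=> [_ Kw] [_ Kw'] Lx wx; apply/eqP; apply: contraT => ww'.
have x0 : x != 0 by apply: contra_neq ww' => x0; apply/eqP; rewrite -subr_eq0 wx x0 mul0rn.
have [z [n [Pz n1 xE]]] := primitive_multiple (lattice_discrete latL) Lx x0.
have half0 : 0 <= 2^-1 :> R by rewrite invr_ge0.
have half1 : 2^-1 <= 1 :> R by rewrite invf_le1 // ler1n.
have := difference_body_convex convC Kw (difference_bodyN Kw') half0 half1.
have -> : 1 - 2^-1 = 2^-1 :> R by lra.
rewrite -scalerDr -scalerBr wx -(scaler_nat 3 x) xE !scalerA.
move=> /(difference_body_le Pz); nra.
Qed.

(* If k < d, the supporting slabs of the k diameter directions are all parallel to
   some v != 0. Intersecting them with a slightly enlarged homothet of C gives a
   strictly larger body (it is longer in direction v) of the same lattice diameter. *)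
Lemma complete_many_diameters k (M : 'M[R]_(k, d)) : lattice_complete L C ->
  (forall i, primitive_diameters (row i M)) ->
  (forall w, primitive_diameters w -> exists i, w = row i M) -> (d <= k)%N.
Proof.
move=> complC WM Mall; rewrite leqNgt; apply/negP => kd.
have [cC convC _] := CB; have cK := difference_body_compact cC.
have [x0 [r [Cx0 r0 hr]]] := convex_body_cube CB.
have D0 := lattice_diam_gt0; have [D2 D2D hD2] := primitive_diameters_gap.
have Kr x : `|x| <= r -> K x.
  by move=> xr; exists (x0 + x); [apply: hr|exists x0]; rewrite // addrC ?addKr ?addrK.
(* No multiple of D w_i by a factor s > 1 lies in [K], so [K] has a supporting functional there. *)
have /fin_all_exists[u hu] : forall i, exists u, (forall z, K z -> dotv u z <= 1) /\
    1 <= dotv u (D *: row i M).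
  move=> i; have [Pi Ki] := WM i.
  apply: (support_functional cK (difference_body_convex convC) r0 Kr) => s s1.
  by rewrite scalerA => /(difference_body_le Pi); nra.
have /fin_all_exists[a ha] : forall i, exists a, C a /\ C (a + D *: row i M).
  by move=> i; have [_ [b Cb [a Ca <-]]] := WM i; exists a; rewrite addrC subrK.
have [v v0 hv] := orthogonal_vector (\matrix_i u i) kd.
have {}hv i : dotv (u i) v = 0 by have := hv i; rewrite rowK.
have [m [m0 Cm hm]] := line_max cC Cx0 v0.
have {}m0 : 0 < m.
  have nv : 0 < `|v| by rewrite normr_gt0.
  apply: (@lt_le_trans _ _ (r / `|v|)); first by rewrite divr_gt0.
  apply: hm; apply: hr; rewrite addrC addKr normrZ normrM normfV normr_id gtr0_norm //.
  by rewrite divfK ?gt_eqF.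
(* Chosen so that (1 + t) D2 <= D; the absolute value covers a negative [D2]. *)
pose t := (D - D2) / (D + `|D2|).
have DD2 : 0 < D + `|D2| by rewrite ltr_pwDl.
have tD : t * (D + `|D2|) = D - D2 by rewrite divfK ?gt_eqF.
have t0 : 0 < t by rewrite divr_gt0 // subr_gt0.
have t10 : 0 < 1 + t by rewrite addr_gt0.
pose hom x := x0 + (1 + t) *: (x - x0).
(* Since u_i takes the value 1 at D w_i, the points a_i and a_i + D w_i of [C] lie on the two
   bounding hyperplanes of slab i. *)
pose C' := hom @` C `&` \bigcap_(i in [set: 'I_k])
  ([set x | dotv (u i) (a i) <= dotv (u i) x] `&` [set x | dotv (u i) x <= 1 + dotv (u i) (a i)]).
have CC' : C `<=` C'.
  move=> x Cx; split.
    exists ((1 + t)^-1 *: x + (1 - (1 + t)^-1) *: x0).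
      by apply: convC => //; rewrite ?invr_ge0 ?invf_le1 ?lerDl // ltW.
    by apply/rowP => j; rewrite /hom !mxE; field; rewrite gt_eqF.
  move=> i _; have [Ca CaD] := ha i; have [u1 uD] := hu i; split=> /=.
    have := u1 (a i + D *: row i M - x) (ex_intro2 _ _ _ CaD (ex_intro2 _ _ _ Cx erefl)).
    by rewrite dotvBr dotvDr; lra.
  have := u1 (x - a i) (ex_intro2 _ _ _ Cx (ex_intro2 _ _ _ Ca erefl)).
  by rewrite dotvBr; lra.
have cC' : compact C'.
  apply: compact_closedI; last first.
    by apply: closed_bigI => i _; apply: closedI; [exact: closed_dotv_ge|exact: closed_dotv_le].
  have cB : continuous (fun x : 'rV[R]_d => x - x0).
    by move=> x; apply: continuousB => //; exact: cst_continuous.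
  apply: continuous_compact => //; apply: continuous_subspaceT => x.
  exact: (cvgD (cvg_cst x0) (cvgZ (cvg_cst (1 + t)) (cB x))).
have homB x y : hom x - hom y = (1 + t) *: (x - y).
  by rewrite /hom opprD addrACA subrr add0r -scalerBr opprB addrA subrK.
have C'B : convex_body C'.
  split=> //.
    move=> x y s [[x' Cx' <-] ux] [[y' Cy' <-] uy] s0 s1; split.
      exists (s *: x' + (1 - s) *: y'); first exact: convC.
      by apply/rowP => j; rewrite /hom !mxE; ring.
    move=> i _; have [] := ux i I; have [] := uy i I; rewrite /= !dotvDr !dotvZr => *; split=> /=; rewrite ?dotvDr ?dotvZr; nra.
  apply: (@interior_of_cube _ _ _ x0 r) => // x xr.
  by apply: CC'; apply: hr; exact: ltW.
apply: (complC C' C'B).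
  (* Moving along v changes no u_i, so this point stays in every slab, yet it lies beyond the last
     point of [C] on the ray from [x0]. *)
  have C'z : C' (hom (x0 + m *: v)).
    split; first by exists (x0 + m *: v).
    move=> i _; have [_ /(_ i I)] := CC' _ Cx0.
    by rewrite /= /hom [_ - x0]addrC addKr dotvDr !dotvZr hv !mulr0 addr0.
  split=> // /(_ _ C'z); rewrite /hom [_ - x0]addrC addKr scalerA => /hm; nra.
apply/eqP; rewrite eq_le; apply/andP; split.
  apply: lattice_diam_le => //; first by exists x0; exact: CC'.
  move=> p q w s [[p' Cp' <-] up] [[q' Cq' <-] uq] [Pw s0]; rewrite homB => pq.
  (* Along a diameter direction the slab caps the length at D; along other primitive directions the
     homothety allows at most (1 + t) D2. *)
  have [Ww|nW] := pselect (primitive_diameters w).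
    have [i wE] := Mall _ Ww.
    have [_ uD] := hu i.
    have [+ _] := up i I; have [_ +] := uq i I; rewrite /= => uq1 up1.
    have : dotv (u i) (s *: w) <= 1 by rewrite -pq -homB dotvBr; lra.
    move: uD; rewrite -wE !dotvZr => h1 h2.
    rewrite leNgt; apply/negP => Ds; nra.
  have : K ((s / (1 + t)) *: w).
    exists q' => //; exists p' => //; apply: (@scalerI _ _ (1 + t)); first by rewrite gt_eqF.
    by rewrite pq scalerA mulrC divfK ?gt_eqF.
  move=> /(hD2 _ _ Pw nW); rewrite ler_pdivrMr // => /le_trans; apply.
  have := ler_norm D2; nra.
apply: lattice_diam_le => //; first by exists x0.
by move=> p q w s /CC' Cp /CC' Cq; exact: lattice_diam_ub.
Qed.

Lemma complete_log_dim : lattice_complete L C ->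
  exists m : nat, (ln 3)^-1 * ln d%:R <= m%:R :> R /\
    dim_span_ge (diameter_directions L C) m.
Proof.
move=> complC.
have [|||m [hm [k [M [WM rM]]]]] := log_dim_span d0 (lattice_discrete latL) primitive_diameters_finite.
- by move=> w [[]].
- exact: primitive_diameters_mod3.
- by move=> k M; exact: complete_many_diameters.
exists m; split=> //; exists k, M; split=> // i.
have [Pi [b Cb [a Ca ab]]] := WM i; have [Li i0 _] := Pi.
split=> //; split=> //; exists a, b, (row i M); split=> //.
  by split=> //; exact/ltW/lattice_diam_gt0.
by exists 1; rewrite oner_eq0 scale1r.
Qed.

End CompleteBodies.

(** * Bodies with an integer point in each facet *)

Section IntegerLattice.
Context {R : realType} {d : nat}.
Local Notation intmx := (map_mx (intr : int -> R)).

Definition integer_lattice : set 'rV[R]_d := range (fun z : 'rV[int]_d => intmx z).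

Lemma integer_lattice_is_lattice : is_lattice integer_lattice.
Proof.
split.
- by exists 0; rewrite // map_mx0.
- by move=> _ _ [x _ <-] [y _ <-]; exists (x - y); rewrite // map_mxB.
- apply/nbhs_ballP; exists 1 => //= x; rewrite -ball_normE /= sub0r normrN.
  move=> /rV_norm_ltP x1 [z _ zx]; apply/rowP => j; rewrite -zx !mxE.
  have := x1 ltr01 j; rewrite -zx mxE -intr_norm -[1]/(1%:~R) ltr_int => zj.
  by have -> : z 0 j = 0 by lia.
- exists d, 1%:M; split; last by rewrite mxrank1.
  by move=> i; exists (row i 1%:M); rewrite // map_row map_mx1.
Qed.

Lemma integer_lattice_dual : dual_lattice integer_lattice = integer_lattice.
Proof.
apply/seteqP; split=> [y Ly|_ [z _ <-] _ [x _ <-]]; last first.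
  exists (\sum_j x 0 j * z 0 j); rewrite /dotv rmorph_sum.
  by apply: eq_bigr => j _; rewrite !mxE rmorphM.
have /fin_all_exists[z zy] : forall j : 'I_d, exists z : int, y 0 j = z%:~R.
  move=> j; have [|z zE] := Ly (delta_mx 0 j).
    by exists (delta_mx 0 j); rewrite // map_delta_mx.
  by exists z; rewrite -zE dotvC dotv_delta.
by exists (\row_j z j) => //; apply/rowP => j; rewrite !mxE zy.
Qed.

End IntegerLattice.
Arguments integer_lattice R d : clear implicits.

(* A family of functionals g_t whose unit ball contains no nonzero integer point in
   its interior, with an integer point y_t in the relative interior of each facet. *)
Section ExtremalBodies.
Context {R : realType} {d k : nat} {T : finType}.
Variables (g : T -> 'rV[R]_d) (y : T -> 'rV[R]_d) (t0 : T) (b : R) (U : 'M[R]_(k, d)).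
Local Notation Z := (integer_lattice R d).
Hypotheses (d0 : (0 < d)%N) (b0 : 0 < b).
Hypothesis g_bounded : forall x, (forall t, `|dotv (g t) x| <= 1) -> `|x| <= b.
Hypothesis g_integer : forall z, Z z -> z != 0 -> exists t, 1 <= `|dotv (g t) z|.
Hypothesis y_integer : forall t, Z (y t).
Hypothesis g_y : forall t, dotv (g t) (y t) = 1.
Hypothesis g_y_lt1 : forall s t, s != t -> `|dotv (g s) (y t)| < 1.
Hypothesis g_short : forall z, Z z -> (forall t, `|dotv (g t) z| <= 1) -> (z <= U)%MS.

Definition slab_body : set 'rV[R]_d := [set x | forall t, `|dotv (g t) x| <= 1].

(** This is the convex hull of the points g_t and -g_t, encoded by duality. *)
Definition polar_body : set 'rV[R]_d := [set x | forall z, slab_body z -> dotv x z <= 1].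

Let y_neq0 t : y t != 0.
Proof.
by apply: contra_eq_neq (g_y t) => ->; rewrite dotv0r eq_sym oner_eq0.
Qed.

Lemma slab_body_y t : slab_body (y t).
Proof.
move=> s; have [->|st] := eqVneq s t; first by rewrite g_y normr1.
exact/ltW/g_y_lt1.
Qed.

Lemma slab_bodyN x : slab_body x -> slab_body (- x).
Proof. by move=> h t; rewrite dotvNr normrN. Qed.

Lemma polar_bodyN x : polar_body x -> polar_body (- x).
Proof. by move=> h z hz; rewrite dotvNl -dotvNr; exact/h/slab_bodyN. Qed.

Lemma polar_body_g t : polar_body (g t).
Proof. by move=> z /(_ t); exact/le_trans/ler_norm. Qed.

Lemma slab_body_cube : exists2 r : R, 0 < r & forall x, `|x| <= r -> slab_body x.
Proof.
have [|r r0 hr] := @finite_gap R T setT (fun t => (1 + d%:R * `|g t|)^-1) 0 finite_finset.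
  by move=> t _; rewrite invr_gt0 ltr_pwDl // mulr_ge0.
exists r => // x xr t; apply: le_trans (norm_dotv_le _ _) _.
have gt0 : 0 < 1 + d%:R * `|g t| by rewrite ltr_pwDl // mulr_ge0.
have := le_trans xr (hr t I); rewrite -[leRHS]mul1r ler_pdivlMr // mulrC => h.
by apply: le_trans h; rewrite ler_wpM2r // lerDr.
Qed.

Lemma slab_body_convex_body : convex_body slab_body.
Proof.
split.
- apply: bounded_closed_compact; first exact: bounded_set_of_le g_bounded.
  have -> : slab_body = \bigcap_(t in [set: T])
      ([set x | -1 <= dotv (g t) x] `&` [set x | dotv (g t) x <= 1]).
    apply/seteqP; split=> x h t => [_|].
      by have := h t; rewrite ler_norml => /andP[].
    by have [] := h t I; rewrite /= ler_norml => -> ->.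
  apply: closed_bigI => t _; apply: closedI; [exact: closed_dotv_ge|exact: closed_dotv_le].
- move=> p q s hp hq s0 s1 t; have := hp t; have := hq t; rewrite !ler_norml dotvDr !dotvZr.
  by move=> /andP[? ?] /andP[? ?]; apply/andP; split; nra.
- have [r r0 hr] := slab_body_cube; apply: (@interior_of_cube _ _ _ 0 r) => // x.
  by rewrite subr0 => /ltW/hr.
Qed.

Lemma polar_body_convex_body : convex_body polar_body.
Proof.
have [r r0 hr] := slab_body_cube; split.
- apply: bounded_closed_compact.
    apply: (@bounded_set_of_le _ _ _ r^-1) => x hx.
    by apply: norm_le_of_dotv => // z /hr; exact: hx.
  have -> : polar_body = \bigcap_(z in slab_body) [set x | dotv z x <= 1].
    by apply/seteqP; split=> x h z hz; have := h z hz; rewrite /= dotvC.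
  by apply: closed_bigI => z _; exact: closed_dotv_le.
- move=> p q s hp hq s0 s1 z hz; have := hp z hz; have := hq z hz.
  by rewrite dotvDl !dotvZl; nra.
- have db : 0 < d%:R * b by rewrite mulr_gt0 // ltr0n.
  apply: (@interior_of_cube _ _ _ 0 (d%:R * b)^-1); first by rewrite invr_gt0.
  move=> x; rewrite subr0 => /ltW; rewrite -[leRHS]mul1r ler_pdivlMr // => hx z hz.
  apply: le_trans (ler_norm _) _; apply: le_trans (norm_dotv_le _ _) _.
  apply: le_trans hx; rewrite mulrCA mulrA ler_wpM2l ?mulr_ge0 //.
  exact: g_bounded.
Qed.

(** The other functionals are strictly below 1 in absolute value at y_t, and there are finitely
    many, so a small step inside the facet hyperplane is harmless. *)
Lemma slab_body_facet t v : dotv (g t) v = 0 ->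
  exists2 e : R, 0 < e & slab_body (y t + e *: v).
Proof.
move=> gv.
pose f s := if s == t then 1 else (1 - `|dotv (g s) (y t)|) / (1 + `|dotv (g s) v|).
have pos s : 0 < 1 + `|dotv (g s) v| by rewrite ltr_pwDl.
have [|e e0 he] := @finite_gap R T setT f 0 finite_finset.
  move=> s _; rewrite /f; case: eqVneq => // st.
  by rewrite divr_gt0 // subr_gt0 g_y_lt1.
exists e => // s; rewrite dotvDr dotvZr.
have [->|st] := eqVneq s t; first by rewrite gv mulr0 addr0 g_y normr1.
have := he s I; rewrite /f (negbTE st) ler_pdivlMr // => h.
apply: le_trans (ler_normD _ _) _; rewrite normrM gtr0_norm //; nra.
Qed.

(** Let w = x - g_t, and let v be w made tangent to facet t by subtracting a multiple of y_t. Then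
    x.v = |w|^2, so a step from y_t along v would push x above 1 unless w = 0. *)
Lemma polar_body_maximizer t x : polar_body x -> dotv x (y t) = 1 -> x = g t.
Proof.
move=> hx xy; pose w := x - g t; pose v := w - dotv (g t) w *: y t.
have [|e e0 /hx] := @slab_body_facet t v.
  by rewrite dotvBr dotvZr g_y mulr1 subrr.
have xv : dotv x v = dotv w w.
  by rewrite /v dotvBr dotvZr xy mulr1 -dotvBl.
rewrite dotvDr xy dotvZr xv gerDl pmulr_rle0 // => w0.
apply/eqP; rewrite -subr_eq0; apply: contraLR w0 => w0.
by rewrite -ltNge; exact: dotvv_gt0.
Qed.

Lemma dir_width_polar_body z t : `|dotv (g t) z| *+ 2 <= dir_width polar_body z.
Proof.
have [cC _ _] := polar_body_convex_body.
have h1 := dir_width_ub z cC (polar_body_g t) (polar_bodyN (polar_body_g t)).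
have h2 := dir_width_ub z cC (polar_bodyN (polar_body_g t)) (polar_body_g t).
move: h1 h2; rewrite !dotvBr !dotvNr !(dotvC z) => h1 h2.
have : `|dotv (g t) z| <= dir_width polar_body z / 2; last by lra.
by rewrite ler_norml; apply/andP; split; lra.
Qed.

Lemma dir_width_polar_body_y t : dir_width polar_body (y t) = 2.
Proof.
have [cC _ _] := polar_body_convex_body.
apply/eqP; rewrite eq_le; apply/andP; split; last first.
  by have := dir_width_polar_body (y t) t; rewrite g_y normr1.
apply: dir_width_le => [|p q hp hq]; first by exists (g t); exact: polar_body_g.
have := hp _ (slab_body_y t); have := polar_bodyN hq (slab_body_y t).
by rewrite dotvBr !(dotvC (y t)) dotvNl; lra.
Qed.

Lemma lattice_width_polar_body : lattice_width Z polar_body = 2.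
Proof.
have [cC _ _] := polar_body_convex_body.
have C0 : polar_body !=set0 by exists (g t0); exact: polar_body_g.
apply/eqP; rewrite eq_le; apply/andP; split.
  rewrite -(dir_width_polar_body_y t0); apply: lattice_width_le => //.
  by rewrite integer_lattice_dual.
apply: lb_le_inf; rewrite integer_lattice_dual.
  by exists (dir_width polar_body (y t0)), (y t0).
move=> _ [z [Zz z0] <-]; have [t zt] := g_integer Zz z0.
by apply: le_trans (dir_width_polar_body z t); rewrite ler_pMn2r.
Qed.

(** Width 2 along y_t is attained only by the pair g_t, -g_t, so a smaller body of the same width
    contains all these points. Separation then shows that it contains the whole polar body. *)
Lemma polar_body_reduced : lattice_reduced Z polar_body.
Proof.
move=> C' [cC' convC' iC'] [C'C nCC']; rewrite lattice_width_polar_body.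
have C'0 : C' !=set0 by have [c /interior_subset] := iC'; exists c.
have wlt t : ~ (C' (g t) /\ C' (- g t)) -> lattice_width Z C' < 2.
  move=> nC't; apply: le_lt_trans (_ : dir_width C' (y t) < _).
    by apply: lattice_width_le => //; rewrite integer_lattice_dual.
  have [p [q [C'p C'q ->]]] := dir_width_attained (y t) cC' C'0.
  have hp := C'C _ C'p (y t) (slab_body_y t).
  have hq := polar_bodyN (C'C _ C'q) (slab_body_y t).
  rewrite dotvBr !(dotvC (y t)); rewrite dotvNl in hq.
  rewrite lt_neqAle; apply/andP; split; last by lra.
  apply/eqP => pq; apply: nC't; split.
    by rewrite -(@polar_body_maximizer t p) //; [exact: C'C|lra].
  rewrite -(@polar_body_maximizer t (- q)) ?opprK //; first exact/polar_bodyN/C'C.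
  by rewrite dotvNl; lra.
have [[t /wlt h2]|hg] := pselect (exists t, ~ (C' (g t) /\ C' (- g t))).
  by apply/eqP; rewrite lt_eqF.
have {}hg t : C' (g t) /\ C' (- g t) by apply: contra_notP hg => ?; exists t.
have /existsNP[x /not_implyP[hx nC'x]] := nCC'.
have [u hu] := strict_separation cC' convC' C'0 nC'x.
have [|e e0 he] := @finite_gap R T setT (fun t => dotv u x - `|dotv (g t) u|) 0 finite_finset.
  move=> t _; rewrite subr_gt0 ltr_norml ltrNl -dotvNl !(dotvC _ u).
  by have [/hu -> /hu ->] := hg t.
(* The margin e puts u / m into the slab body; polarity then gives u.x <= m, a contradiction. *)
pose m := dotv u x - e / 2.
have m0 : 0 < m.
  by have := he t0 I; have := normr_ge0 (dotv (g t0) u); rewrite /m; lra.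
have : slab_body (m^-1 *: u).
  move=> t; rewrite dotvZr normrM normfV (gtr0_norm m0) mulrC ler_pdivrMr // mul1r.
  by have := he t I; rewrite /m; lra.
by move=> /hx; rewrite dotvZr dotvC mulrC ler_pdivrMr // mul1r /m; lra.
Qed.

(** The width along z is at least 2 |g_t.z|, so width directions are integer points of the slab body
    and [g_short] applies. *)
Lemma polar_body_width_directions (x : R) : k%:R <= x ->
  dim_span_le (width_directions Z polar_body) x.
Proof.
move=> kx n M WM; apply: le_trans kx; rewrite ler_nat.
apply: leq_trans (rank_leq_row U); apply/mxrankS/row_subP => i.
have [+ [_ +]] := WM i; rewrite integer_lattice_dual lattice_width_polar_body => Zi wi.
apply: g_short => // t; rewrite -(ler_pMn2r (ltn0Sn 1)).
by apply: le_trans (dir_width_polar_body _ t) _; rewrite wi.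
Qed.

Let y_primitive t : primitive_vec Z (y t).
Proof.
split=> // s s0 s1 Zs; have [|u] := g_integer Zs.
  by rewrite scaler_eq0 negb_or gt_eqF // y_neq0.
rewrite dotvZr normrM gtr0_norm // leNgt => /negP; apply.
apply: le_lt_trans s1; rewrite -[leRHS]mulr1 ler_wpM2l //; [exact: ltW|exact: slab_body_y].
Qed.

Lemma lattice_diam_slab_body : lattice_diam Z slab_body = 2.
Proof.
have [cC _ _] := slab_body_convex_body.
apply/eqP; rewrite eq_le; apply/andP; split.
  apply: (lattice_diam_le integer_lattice_is_lattice) => //.
    by exists (y t0); exact: slab_body_y.
  move=> p q w s hp hq [[Zw w0 _] s0 pq]; have [t wt] := g_integer Zw w0.
  have : s * `|dotv (g t) w| <= 2; last by nra.
  rewrite -[X in X * _]ger0_norm // -normrM -dotvZr -pq dotvBr.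
  by apply: le_trans (ler_normB _ _) _; rewrite -[2]/(1 + 1); exact: lerD.
apply: (lattice_diam_ub integer_lattice_is_lattice cC (slab_bodyN (slab_body_y t0)) (slab_body_y t0)).
by split=> //; rewrite opprK -mulr2n scaler_nat.
Qed.

(** A new point beyond facet t, combined with a facet point near y_t, yields a multiple rho y_t with
    rho > 1 (up to sign). Joined to -y_t it gives lattice length 1 + rho > 2. *)
Lemma slab_body_complete : lattice_complete Z slab_body.
Proof.
move=> C' [cC' convC' _] [CC' nC'C]; rewrite lattice_diam_slab_body.
have /existsNP[x /not_implyP[C'x nCx]] := nC'C.
have /existsNP[t /negP] := nCx; rewrite -ltNge => gx.
(* [C'] need not be symmetric, so the sign s is carried along. *)
have [s [x' [s1 x'E gx']]] : exists s x', [/\ `|s| = 1 :> R, x' = s *: x & 1 < dotv (g t) x'].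
  have [gx0|gx0] := leP 0 (dotv (g t) x).
    by exists 1, x; rewrite normr1 scale1r -[dotv _ _]ger0_norm.
  by exists (-1), (- x); rewrite normrN1 scaleN1r dotvNr -ltr0_norm.
(* With weights e / (1 + e) and 1 / (1 + e), the points x' and y_t + e v average to rho y_t. *)
pose v := dotv (g t) x' *: y t - x'.
have [|e e0 he] := @slab_body_facet t v; first by rewrite dotvBr dotvZr g_y mulr1 subrr.
have e1 : 0 < 1 + e by rewrite addr_gt0.
pose rho := (1 + e * dotv (g t) x') / (1 + e).
have rho1 : 1 < rho by rewrite ltr_pdivlMr // mul1r ltrD2l -[ltLHS]mulr1 ltr_pM2l.
have C's z : slab_body z -> C' (s *: z).
  move=> hz; apply: CC' => t'; rewrite dotvZr normrM s1 mul1r; exact: hz.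
have C'rho : C' (s *: (rho *: y t)).
  have := convC' x (s *: (y t + e *: v)) (e / (1 + e)) C'x (C's _ he).
  have -> : (e / (1 + e)) *: x + (1 - e / (1 + e)) *: (s *: (y t + e *: v)) = s *: (rho *: y t).
    have -> : x = s *: x' by rewrite x'E scalerA -expr2 -real_normK ?num_real // s1 expr1n scale1r.
    apply/rowP => j; rewrite /v /rho !mxE; field; exact: lt0r_neq0.
  by apply; [rewrite divr_ge0 ?ltW|rewrite ler_pdivrMr // mul1r lerDr].
have C'y : C' (s *: (- y t)) by apply/C's/slab_bodyN/slab_body_y.
suff h : 1 + rho <= lattice_diam Z C' by apply/eqP; rewrite gt_eqF //; apply: lt_le_trans h; lra.
have latZ := @integer_lattice_is_lattice R d.
have rho0 : 0 <= 1 + rho by lra.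
have [sE|sE] : s = 1 \/ s = -1.
- by move: s1; case: ler0P => _ sE; [right|left]; rewrite -sE ?opprK.
- move: C'y C'rho; rewrite sE !scale1r => C'y C'rho.
  apply: (lattice_diam_ub (w := y t) latZ cC' C'y C'rho); split=> //.
  by rewrite opprK addrC scalerDl scale1r.
- move: C'y C'rho; rewrite sE !scaleN1r opprK => C'y C'rho.
  apply: (lattice_diam_ub (w := y t) latZ cC' C'rho C'y); split=> //.
  by rewrite opprK scalerDl scale1r.
Qed.

Lemma slab_body_diameter_directions (x : R) : k%:R <= x ->
  dim_span_le (diameter_directions Z slab_body) x.
Proof.
move=> kx n M WM; apply: le_trans kx; rewrite ler_nat.
apply: leq_trans (rank_leq_row U); apply/mxrankS/row_subP => i.
have [_ [_ [p [q [w [hp hq [[Zw _ _] _ pq] [s [_ ->]]]]]]]] := WM i.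
apply: scalemx_sub; apply: g_short => // t.
move: pq; rewrite lattice_diam_slab_body => pq.
have : `|dotv (g t) (2 *: w)| <= 1 + 1.
  by rewrite -pq dotvBr; apply: le_trans (ler_normB _ _) _; exact: lerD.
by rewrite dotvZr normrM ger0_norm //; lra.
Qed.

End ExtremalBodies.

(** * The Voronoi cell of the dual root lattice *)

(* In A_k^* = Z^(k+1) / (1,...,1), normalized by a vanishing zeroth coordinate, the
   Voronoi-relevant vectors are the indicators of the subsets S, and the functional
   that supports the Voronoi cell at S is z |-> avg_S z - avg_(S^c) z.  Here S ranges
   over the nonempty subsets of {1..k}; the complement always contains 0, so it
   has k + 1 - |S| elements. *)
Section Averages.
Context {R : realType} {k : nat}.
Implicit Types (S A : {set 'I_k}) (x : 'I_k -> R).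

Definition avg_diff S x : R :=
  (\sum_(i in S) x i) / #|S|%:R - (\sum_(i | i \notin S) x i) / (k.+1 - #|S|)%:R.

Let ccard_gt0 S : 0 < (k.+1 - #|S|)%:R :> R.
Proof. by rewrite ltr0n subn_gt0 ltnS -[k in leqRHS]card_ord max_card. Qed.

Let card_gt0R S : (0 < #|S|)%N -> 0 < #|S|%:R :> R.
Proof. by rewrite ltr0n. Qed.

(** The sum has k - |S| terms but the divisor is k + 1 - |S|: the normalized zeroth coordinate
    counts as a value 0, which [0 <= b] covers. *)
Let avg_notin_le S x (b : R) : 0 <= b -> (forall i, i \notin S -> x i <= b) ->
  (\sum_(i | i \notin S) x i) / (k.+1 - #|S|)%:R <= b.
Proof.
move=> b0 xb; rewrite ler_pdivrMr //.
apply: (@le_trans _ _ (b * (k - #|S|)%:R)); last by rewrite ler_wpM2l // ler_nat leq_sub2r.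
have hC : (#|S| + #|[predC S]| = k)%N := etrans (cardC (mem S)) (card_ord k).
have -> : (k - #|S|)%N = #|[predC S]| by lia.
by rewrite mulr_natr -sumr_const; exact: ler_sum.
Qed.

Definition avg_vec S : 'rV[R]_k :=
  \row_i (if i \in S then #|S|%:R^-1 else - (k.+1 - #|S|)%:R^-1).

Lemma dotv_avg_vec S (x : 'rV[R]_k) : dotv (avg_vec S) x = avg_diff S (x 0).
Proof.
rewrite /dotv (bigID (mem S)) /= /avg_diff !mulr_suml -sumrN.
congr (_ + _); apply: eq_bigr => i iS; rewrite mxE.
  by rewrite iS mulrC.
by rewrite (negbTE iS) mulNr mulrC.
Qed.

Lemma avg_diffN S x : avg_diff S (fun i => - x i) = - avg_diff S x.
Proof. by rewrite /avg_diff !sumrN; ring. Qed.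

Lemma avg_diff_set1 i x :
  avg_diff [set i]%SET x *+ k = x i *+ k.+1 - \sum_j x j.
Proof.
have k0 : k%:R != 0 :> R by rewrite pnatr_eq0 -lt0n; case: k i => // -[].
rewrite /avg_diff cards1 subn1 /= divr1 big_set1 [in RHS](bigD1 i) //= mulrnBl.
rewrite -[_ / _ *+ k]mulr_natr divfK // mulrSr.
under eq_bigl do rewrite inE.
by ring.
Qed.

(** Summing [avg_diff_set1] over i bounds the coordinate sum by k^2. Then (k + 1) |x_i| <= k +
    k^2. *)
Lemma avg_diff_set1_bounded x : (forall i, `|avg_diff [set i]%SET x| <= 1) ->
  forall i, `|x i| <= k%:R.
Proof.
move=> h i; have k0 : 0 < k%:R :> R by rewrite ltr0n; case: k i {h x} => // -[].
pose s := \sum_j x j.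
have sE : s = (\sum_j avg_diff [set j]%SET x) *+ k.
  rewrite -sumrMnl; under eq_bigr do rewrite avg_diff_set1.
  by rewrite sumrB sumrMnl -/s sumr_const card_ord mulrSr addrAC subrr add0r.
have sk : `|s| <= k%:R * k%:R.
  rewrite sE normrMn -[leLHS]mulr_natr ler_wpM2r //.
  apply: le_trans (ler_norm_sum _ _ _) _.
  by apply: le_trans (ler_sum _ (fun j _ => h j)) _; rewrite sumr_const card_ord.
have := avg_diff_set1 i x; rewrite -/s -[_ *+ k]mulr_natr -[_ *+ k.+1]mulr_natr -natr1.
move: (h i) sk; rewrite !ler_norml => /andP[? ?] /andP[? ?] ?.
apply/andP; split; nra.
Qed.

Lemma avg_diff_bounded S x (b : R) : (0 < #|S|)%N -> (forall i, `|x i| <= b) ->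
  `|avg_diff S x| <= b *+ 2.
Proof.
move=> S0 xb; have /card_gt0P[i iS] := S0.
have b0 : 0 <= b := le_trans (normr_ge0 _) (xb i).
rewrite mulr2n; apply: le_trans (ler_normB _ _) _.
rewrite !normrM !normfV !normr_nat; apply: lerD.
  rewrite ler_pdivrMr ?card_gt0R // mulr_natr -sumr_const.
  apply: le_trans (ler_norm_sum _ _ _) _; exact: ler_sum.
apply: le_trans (_ : (\sum_(i | i \notin S) `|x i|) / _ <= _); last exact: avg_notin_le.
by rewrite ler_wpM2r ?invr_ge0 // ler_norm_sum.
Qed.

(** Up to sign some entry is positive. Let S be where the maximum M is attained: all other entries,
    including the hidden 0, are at most M - 1. *)
Lemma avg_diff_integer (z : 'I_k -> int) : (exists i, z i != 0) ->
  exists2 S : {set 'I_k}, (0 < #|S|)%N & 1 <= `|avg_diff S (fun i => (z i)%:~R)|.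
Proof.
wlog [i zi] : z / exists i, 0 < z i.
  move=> H [i zi]; have [zp|zn] := ltP 0 (z i); first by apply: H; exists i.
  have [||S S0 hS] := H (fun i => - z i).
  - by exists i; rewrite oppr_gt0 lt_neqAle zi.
  - by exists i; rewrite oppr_eq0.
  exists S => //; rewrite -normrN -avg_diffN.
  have -> : (fun i => - (z i)%:~R) = (fun i => (- z i)%:~R : R) by apply/funext => l; rewrite rmorphN.
  exact: hS.
move=> _; pose m := [arg max_(j > i) z j]%O; pose M := z m.
have zM j : z j <= M by rewrite /M /m; case: arg_maxP => // m' _; exact.
have M0 : 0 < M := lt_le_trans zi (zM i).
pose S := [set j | z j == M]%SET.
have S0 : (0 < #|S|)%N by apply/card_gt0P; exists m; rewrite inE.
exists S => //; apply: le_trans (ler_norm _).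
rewrite /avg_diff (eq_bigr (fun=> M%:~R)) => [|j]; last by rewrite inE => /eqP ->.
rewrite sumr_const -[_ *+ #|_|]mulr_natr mulfK ?gt_eqF ?card_gt0R //.
suff : (\sum_(j | j \notin S) (z j)%:~R) / (k.+1 - #|S|)%:R <= M%:~R - 1 :> R by lra.
have M1 : 0 <= M%:~R - 1 :> R by rewrite subr_ge0 -[1]/(1%:~R) ler_int.
apply: avg_notin_le => // j; rewrite inE => zj; rewrite -[1]/(1%:~R) -rmorphB ler_int.
by have := zM j; lia.
Qed.

Lemma avg_diff_indicator S : (0 < #|S|)%N -> avg_diff S (fun i => (i \in S)%:R) = 1.
Proof.
move=> S0; rewrite /avg_diff (eq_bigr (fun=> 1)) => [|i ->//].
rewrite [X in _ - X / _]big1 => [|i /negbTE ->//].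
by rewrite sumr_const mul0r subr0 divff // gt_eqF // card_gt0R.
Qed.

(** The value is |S ∩ A| / |S| - |A \ S| / (k + 1 - |S|). The second quotient is below 1 thanks to
    the hidden coordinate, and the difference is 1 only if A = S. *)
Lemma avg_diff_indicator_lt1 S A : (0 < #|S|)%N -> S != A ->
  `|avg_diff S (fun i => (i \in A)%:R)| < 1.
Proof.
move=> S0 SA; rewrite /avg_diff -!natr_sum.
have -> : (\sum_(i in S) (i \in A) = #|(S :&: A)%SET|)%N.
  rewrite -sum1_card big_mkcond [RHS]big_mkcond; apply: eq_bigr => i _ /=.
  by rewrite inE; case: (i \in S); case: (i \in A).
have -> : (\sum_(i | i \notin S) (i \in A) = #|(A :\: S)%SET|)%N.
  rewrite -sum1_card big_mkcond [RHS]big_mkcond; apply: eq_bigr => i _ /=.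
  by rewrite inE; case: (i \in S); case: (i \in A).
have aS : (#|(S :&: A)%SET| <= #|S|)%N by rewrite subset_leq_card ?subsetIl.
have cS : (#|(A :\: S)%SET| < k.+1 - #|S|)%N.
  have : (#|(A :\: S)%SET| <= #|(~: S)%SET|)%N by rewrite subset_leq_card ?subsetDr.
  by have := cardsC S; rewrite card_ord; lia.
have : (#|(S :&: A)%SET| < #|S|)%N || (0 < #|(A :\: S)%SET|)%N.
  apply: contraR SA; rewrite negb_or -leqNgt -eqn0Ngt cards_eq0 finset.setD_eq0 => /andP[le_a AS].
  rewrite finset.eqEsubset AS andbT; apply/finset.setIidPl/eqP; rewrite eqEcard le_a andbT; exact: subsetIl.
move: aS cS (ccard_gt0 S) (card_gt0R S0).
move: #|(S :&: A)%SET| #|(A :\: S)%SET| #|S| (k.+1 - #|S|)%N => a c n m an cm m0 n0 ac.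
have a0 : 0 <= a%:R / n%:R :> R by rewrite divr_ge0 ?ler0n.
have c0 : 0 <= c%:R / m%:R :> R by rewrite divr_ge0 ?ler0n.
have a1 : a%:R / n%:R <= 1 :> R by rewrite ler_pdivrMr // mul1r ler_nat.
have c1 : c%:R / m%:R < 1 :> R by rewrite ltr_pdivrMr // mul1r ltr_nat.
rewrite ltr_norml; apply/andP; split; first by lra.
case/orP: ac => [an'|c0'].
  have : a%:R / n%:R < 1 :> R by rewrite ltr_pdivrMr // mul1r ltr_nat.
  by lra.
have : 0 < c%:R / m%:R :> R by rewrite divr_gt0 // ltr0n.
by lra.
Qed.

End Averages.

(** * The extremal example *)

(* The first k coordinates carry A_k^*.  The remaining e ones are attached, with a
   large weight, to distinct functionals of non-singletons, so that every integer
   vector of norm at most 1 lies in the k-dimensional coordinate subspace. *)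
Section LogarithmicExample.
Context {R : realType} {k e : nat}.
Variable c : 'I_e -> {set 'I_k}.
Hypotheses (k0 : (0 < k)%N) (c_inj : injective c) (c_card : forall j, (1 < #|c j|)%N).
Local Notation T := {S : {set 'I_k} | (0 < #|S|)%N}.
Local Notation Z := (integer_lattice R (k + e)).

Lemma dotv_row_mx m n (a x : 'rV[R]_m) (b y : 'rV[R]_n) :
  dotv (row_mx a b) (row_mx x y) = dotv a x + dotv b y.
Proof. by rewrite !dotvE tr_row_mx mul_row_col mxE. Qed.

Definition weighted_avg (S : T) : 'rV[R]_(k + e) :=
  row_mx (avg_vec (val S)) (\row_j (k.+1.*2%:R * (c j == val S)%:R)).

Definition indicator (S : T) : 'rV[R]_(k + e) := row_mx (\row_i (i \in val S)%:R) 0.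

Let dotv_weighted_avg0 S (x1 : 'rV[R]_k) (x2 : 'rV[R]_e) :
  (forall j, c j == val S -> x2 0 j = 0) ->
  dotv (weighted_avg S) (row_mx x1 x2) = avg_diff (val S) (x1 0).
Proof.
move=> h; rewrite dotv_row_mx dotv_avg_vec [X in _ + X]big1 ?addr0 // => j _.
rewrite mxE; case: (boolP (c j == val S)) => [/h ->|_]; first by rewrite mulr0.
by rewrite mulr0 mul0r.
Qed.

Let dotv_weighted_avg_c S j (x1 : 'rV[R]_k) (x2 : 'rV[R]_e) : c j = val S ->
  dotv (weighted_avg S) (row_mx x1 x2) = avg_diff (val S) (x1 0) + k.+1.*2%:R * x2 0 j.
Proof.
move=> cj; rewrite dotv_row_mx dotv_avg_vec /dotv (bigD1 j) //= mxE cj eqxx mulr1.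
rewrite [X in _ + (_ + X)]big1 ?addr0 // => i ij.
rewrite mxE -cj; case: eqP => [/c_inj ij'|_]; last by rewrite mulr0 mul0r.
by rewrite ij' eqxx in ij.
Qed.

(** Singletons carry no extra coordinate and bound [x1] by k, so every average difference is at most
    2k. Then 2 (k + 1) |x2_j| <= 2k + 1, which explains the weight. *)
Let weighted_avg_bound (x1 : 'rV[R]_k) (x2 : 'rV[R]_e) :
  (forall S, `|dotv (weighted_avg S) (row_mx x1 x2)| <= 1) ->
  (forall i, `|x1 0 i| <= k%:R) /\ (forall j, `|x2 0 j| < 1).
Proof.
move=> h; have x1k i : `|x1 0 i| <= k%:R.
  apply: avg_diff_set1_bounded => l.
  have l0 : (0 < #|[set l]%SET|)%N by rewrite cards1.
  have := h (Sub [set l]%SET l0); rewrite dotv_weighted_avg0 //= => j /eqP cj.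
  by have := c_card j; rewrite cj cards1.
split=> // j; have cj0 : (0 < #|c j|)%N := ltnW (c_card j).
have := h (Sub (c j) cj0); rewrite (@dotv_weighted_avg_c _ j) //= => h1.
have := avg_diff_bounded cj0 x1k; move: h1; rewrite -muln2 natrM -natr1 mulr2n.
have kR : 0 <= k%:R :> R by [].
rewrite !ler_norml ltr_norml => /andP[? ?] /andP[? ?]; apply/andP; split; nra.
Qed.

Let weighted_avg_bounded x : (forall S, `|dotv (weighted_avg S) x| <= 1) -> `|x| <= k%:R.
Proof.
rewrite -(hsubmxK x) => /weighted_avg_bound[h1 h2]; apply/rV_norm_leP => // j.
rewrite mxE; case: (fintype.split _) => i; first exact: h1.
by apply: le_trans (ltW (h2 i)) _; rewrite ler1n.
Qed.

Let integer_short (z : 'rV[int]_(k + e)) :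
  (forall S, `|dotv (weighted_avg S) (map_mx intr z)| <= 1) -> rsubmx z = 0.
Proof.
rewrite -{1}(hsubmxK z) map_row_mx => /weighted_avg_bound[_ h2].
apply/rowP => j; have := h2 j.
by rewrite !mxE -intr_norm -[1]/(1%:~R) ltr_int => zj; lia.
Qed.

Let weighted_avg_integer z : Z z -> z != 0 -> exists S, 1 <= `|dotv (weighted_avg S) z|.
Proof.
move=> [{}z _ <-] z0; apply: contrapT => h.
have {}h S : `|dotv (weighted_avg S) (map_mx intr z)| < 1.
  by rewrite ltNge; apply/negP => hS; apply: h; exists S.
have z2 : rsubmx z = 0 by apply: integer_short => S; exact: ltW.
have zE : map_mx intr z = row_mx (map_mx intr (lsubmx z)) 0 :> 'rV[R]_(k + e).
  by rewrite -{1}(hsubmxK z) z2 map_row_mx map_mx0.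
have [|S S0] := @avg_diff_integer R k (lsubmx z 0).
  apply: contrapT => h1; move/eqP: z0; apply; rewrite zE -(row_mx0 _ 1 k e); congr row_mx.
  apply/rowP => i; rewrite !mxE; apply: contrapT => zi; apply: h1; exists i.
  by apply: contra_not_neq zi => zi; rewrite mxE in zi; rewrite zi.
rewrite leNgt => /negP; apply; have := h (Sub S S0).
rewrite zE dotv_weighted_avg0 /=; last by move=> j _; rewrite mxE.
suff -> : (map_mx intr (lsubmx z) : 'rV[R]_k) 0 = (fun i => (lsubmx z 0 i)%:~R) by [].
by apply/funext => i; rewrite mxE.
Qed.

Let indicator_integer S : Z (indicator S).
Proof.
exists (row_mx (\row_i (i \in val S)%:R) 0) => //.
rewrite map_row_mx map_mx0; congr row_mx; apply/rowP => i.
by rewrite !mxE; case: (_ \in _).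
Qed.

Let dotv_indicator S A :
  dotv (weighted_avg S) (indicator A) = avg_diff (val S) (fun i => (i \in val A)%:R).
Proof.
rewrite dotv_weighted_avg0 => [|j _]; last by rewrite mxE.
by congr avg_diff; apply/funext => i; rewrite mxE.
Qed.

Let weighted_avg_indicator S : dotv (weighted_avg S) (indicator S) = 1.
Proof. by rewrite dotv_indicator avg_diff_indicator // (valP S). Qed.

Let weighted_avg_indicator_lt1 S A : S != A -> `|dotv (weighted_avg S) (indicator A)| < 1.
Proof. by move=> SA; rewrite dotv_indicator avg_diff_indicator_lt1 // (valP S). Qed.

Let weighted_avg_short z : Z z -> (forall S, `|dotv (weighted_avg S) z| <= 1) ->
  (z <= (row_mx 1%:M 0 : 'M[R]_(k, k + e)))%MS.
Proof.
move=> [{}z _ <-] /integer_short z2; rewrite -(hsubmxK z) z2 map_row_mx map_mx0.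
by apply/submxP; exists (map_mx intr (lsubmx z)); rewrite mul_mx_row mulmx1 mulmx0.
Qed.

Lemma reduced_example (x : R) : k%:R <= x ->
  exists L C : set 'rV[R]_(k + e), [/\ is_lattice L, convex_body C, lattice_reduced L C
    & dim_span_le (width_directions L C) x].
Proof.
move=> kx.
have S1 : (0 < #|[set Ordinal k0]%SET|)%N by rewrite cards1.
pose S0 : T := exist (fun S : {set 'I_k} => 0 < #|S|)%N _ S1.
have kR : 0 < k%:R :> R by rewrite ltr0n.
have d0 : (0 < k + e)%N by rewrite addn_gt0 k0.
exists Z, (polar_body weighted_avg); split.
- exact: integer_lattice_is_lattice.
- exact: (polar_body_convex_body d0 kR weighted_avg_bounded).
- exact: (polar_body_reduced S0 d0 kR weighted_avg_bounded weighted_avg_integer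
    indicator_integer weighted_avg_indicator weighted_avg_indicator_lt1).
- exact: (polar_body_width_directions S0 d0 kR weighted_avg_bounded weighted_avg_integer
    indicator_integer weighted_avg_indicator weighted_avg_indicator_lt1
    weighted_avg_short kx).
Qed.

Lemma complete_example (x : R) : k%:R <= x ->
  exists L C : set 'rV[R]_(k + e), [/\ is_lattice L, convex_body C, lattice_complete L C
    & dim_span_le (diameter_directions L C) x].
Proof.
move=> kx.
have S1 : (0 < #|[set Ordinal k0]%SET|)%N by rewrite cards1.
pose S0 : T := exist (fun S : {set 'I_k} => 0 < #|S|)%N _ S1.
have kR : 0 < k%:R :> R by rewrite ltr0n.
have d0 : (0 < k + e)%N by rewrite addn_gt0 k0.
exists Z, (slab_body weighted_avg); split.
- exact: integer_lattice_is_lattice.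
- exact: (slab_body_convex_body weighted_avg_bounded).
- exact: (slab_body_complete S0 d0 weighted_avg_bounded weighted_avg_integer
    indicator_integer weighted_avg_indicator weighted_avg_indicator_lt1).
- exact: (slab_body_diameter_directions S0 d0 weighted_avg_bounded weighted_avg_integer
    indicator_integer weighted_avg_indicator weighted_avg_indicator_lt1
    weighted_avg_short kx).
Qed.

End LogarithmicExample.

(** * Counting subsets and choosing the dimensions *)

Lemma card_non_singletons k :
  (2 ^ k <= #|[pred S : {set 'I_k} | (1 < #|S|)%N]| + k.+1)%N.
Proof.
have <- : #|{: {set 'I_k}}| = (2 ^ k)%N.
  by rewrite -cardsT -finset.powersetT card_powerset cardsT card_ord.
rewrite -(cardC [pred S : {set 'I_k} | (1 < #|S|)%N]) leq_add2l.
(* The sets with at most one element are the empty set and the singletons, enumerated by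
   [option 'I_k]. *)
pose f (o : option 'I_k) : {set 'I_k} := if o is Some i then [set i]%SET else finset.set0.
have <- : #|{: option 'I_k}| = k.+1 by rewrite card_option card_ord.
apply: leq_trans (leq_image_card f predT); apply/subset_leq_card/fintype.subsetP => S.
rewrite !inE -leqNgt leq_eqVlt ltnS leqn0 => /orP[/cards1P[i ->]|].
  by apply/fintype.imageP; exists (Some i).
by rewrite cards_eq0 => /eqP ->; apply/fintype.imageP; exists None.
Qed.

(** Take k with 2^(k-1) <= d < 2^k. Then d - k <= 2^k - 1 - k, so there are enough sets with at
    least two elements for the extra coordinates. *)
Lemma logarithmic_dimension d : (2 <= d)%N ->
  exists k e (c : 'I_e -> {set 'I_k}), [/\ d = (k + e)%N, (0 < k)%N, (2 ^ k <= 2 * d)%N,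
    injective c & forall j, (1 < #|c j|)%N].
Proof.
move=> d2; have /andP[lo hi] := trunc_log_bounds (isT : 1 < 2)%N (ltnW d2).
pose k := (trunc_log 2 d).+1; rewrite -/k in hi.
have kd : (k <= d)%N by exact: leq_trans (ltn_expl _ (isT : 1 < 2)%N) lo.
pose B := [pred S : {set 'I_k} | (1 < #|S|)%N].
have eB : (d - k <= #|B|)%N.
  rewrite leq_subLR addnC -ltnS -addnS; apply: leq_trans hi _; exact: card_non_singletons.
exists k, (d - k)%N, (fun j => enum_val (widen_ord eB j)); split=> //.
- by rewrite subnKC.
- by rewrite expnS leq_mul2l.
- by move=> i j /enum_val_inj /(congr1 val) ij; exact/val_inj.
- by move=> j; have := enum_valP (widen_ord eB j).
Qed.

Theorem theorem1p3 (R : realType) :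
  (exists c : R, 0 < c /\
    forall (d : nat) (L C : set 'rV[R]_d), (1 <= d)%N ->
      is_lattice L -> convex_body C ->
      (lattice_reduced L C ->
         exists m : nat, c * ln (d%:R) <= m%:R /\ dim_span_ge (width_directions L C) m) /\
      (lattice_complete L C ->
         exists m : nat, c * ln (d%:R) <= m%:R /\ dim_span_ge (diameter_directions L C) m))
  /\
  (exists c' : R, 0 < c' /\
    forall d : nat, (2 <= d)%N ->
      (exists L C : set 'rV[R]_d, [/\ is_lattice L, convex_body C, lattice_reduced L C
          & dim_span_le (width_directions L C) (c' * ln (d%:R))]) /\
      (exists L C : set 'rV[R]_d, [/\ is_lattice L, convex_body C, lattice_complete L C
          & dim_span_le (diameter_directions L C) (c' * ln (d%:R))])).
Proof.
split.
  exists (ln 3)^-1; split; first by rewrite invr_gt0 ln_gt0 // ltr1n.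
  move=> d L C d0 latL CB; split; first exact: reduced_log_dim.
  exact: complete_log_dim.
have ln2 : 0 < ln 2 :> R by rewrite ln_gt0 // ltr1n.
(* As d >= 2, 2^k <= 2d <= d^2, that is, k ln 2 <= 2 ln d. *)
exists (2 / ln 2); split; first by rewrite divr_gt0.
move=> d d2; have [k [e [c [dE k0 kd c_inj c_card]]]] := logarithmic_dimension d2.
have kx : k%:R <= 2 / ln 2 * ln (d%:R : R).
  have d0 : 0 < d%:R :> R by rewrite ltr0n (ltnW d2).
  rewrite mulrAC ler_pdivlMr // mulr_natl -lnXn // mulr_natl -lnXn //.
  rewrite ler_ln ?posrE ?exprn_gt0 // -!natrX ler_nat (leq_trans kd) //.
  by rewrite -mulnn leq_mul2r d2 orbT.
rewrite {}dE in kx *; split.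
  exact: reduced_example c_inj c_card _ kx.
exact: complete_example c_inj c_card _ kx.
Qed.
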